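(* For every $n\ge1$, the homogeneous component $\mathsf{F}_n$ of the series $\mathsf{F}=-\mathbf{N}\mathbf{T}\mathbf{P}$, seen as an element of the symmetric group ring of $\mathfrak{S}_n$, satisfies $$\mathsf{F}_n\cdot\mathsf{F}_n=n\,\mathbf{ca}_n\,\mathsf{F}_n .$$
   Context: **Narayana polynomials.** For $n\ge1$ let $\mathrm{Lnr}_n$ be the chain with $n$ vertices rooted at its bottom vertex. A closed flow on $\mathrm{Lnr}_n$ is a set $O$ of vertices (outputs) and a function $m$ from vertices to $\mathbb{N}$ vanishing on $O$, such that the rates $r(v)=m(v)-[v\in O]+r(\text{child of }v)$ (the last term being $0$ for the top vertex) are all $\ge0$ and the rate at the root is $0$. Then $\mathbf{ca}_n=\sum b^{|O|}\in\mathbb{Z}[b]$, summed over closed flows on $\mathrm{Lnr}_n$ (the Narayana polynomials: $\mathbf{ca}_1=1$, $\mathbf{ca}_2=1+b$, $\mathbf{ca}_3=1+3b+b^2$, …). **Series.** In noncommutative formal power series in two letters $\mathtt{p},\mathtt{m}$ (written $+,-$ in the paper), let $\mathbf{P}=\sum_{k\ge1}\mathbf{ca}_k\mathtt{p}^k$, $\mathbf{N}=\sum_{k\ge1}(-1)^k\mathbf{ca}_k\mathtt{m}^k$, $\mathbf{T}=\sum_{k\ge0}b^k(\mathbf{P}\mathbf{N})^k$. **Identification with group ring elements.** Every word occurring in $\mathbf{N}\mathbf{T}\mathbf{P}$ has the form $\mathtt{m}\,\epsilon\,\mathtt{p}$ with $\epsilon\in\{\mathtt{p},\mathtt{m}\}^{n-1}$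 for some $n\ge1$. The word $\mathtt{m}\epsilon\mathtt{p}$ is identified with the ribbon Schur function of degree $n$ indexed by $\epsilon$ (equivalently with the sum of planar binary trees with $n$ inner vertices and full canopy $\mathtt{m}\epsilon\mathtt{p}$), and, through the embedding of noncommutative symmetric functions in $\bigoplus_n\mathbb{Q}[\mathfrak{S}_n]$, with the sum of all permutations $\sigma\in\mathfrak{S}_n$ such that, for $1\le i\le n-1$, $\sigma(i)>\sigma(i+1)$ if and only if $\epsilon_i=\mathtt{m}$. Thus $\mathsf{F}_n=\sum_{\sigma\in\mathfrak{S}_n}f_{\epsilon(\sigma)}\,\sigma\in\mathbb{Q}[b][\mathfrak{S}_n]$, where $\epsilon(\sigma)$ is the descent word of $\sigma$ and $f_\epsilon$ is the coefficient of $\mathtt{m}\epsilon\mathtt{p}$ in $-\mathbf{N}\mathbf{T}\mathbf{P}$. The product is that of the group ring. *)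

(* Defs.v *)
From mathcomp Require Import all_boot all_order all_algebra all_fingroup.

Set Implicit Arguments.
Unset Strict Implicit.
Unset Printing Implicit Defensive.

Import Order.TTheory GRing.Theory Num.Theory.
Local Open Scope ring_scope.

(* The vertices of the chain [Lnr_n] are the elements of ['I_n], numbered from
   the top: [0] is the top vertex, [n.-1] the root, and the child of [k.+1] is
   [k]. *)

Definition net n (O : {set 'I_n}) (m : 'I_n -> nat) (k : nat) : int :=
  if insub k is Some v then (m v)%:Z - (v \in O : nat)%:Z else 0.

Fixpoint rate n (O : {set 'I_n}) (m : 'I_n -> nat) (k : nat) : int :=
  net O m k + (if k is k'.+1 then rate O m k' else 0).

Definition closed_flow n (O : {set 'I_n}) (m : 'I_n -> nat) : bool :=
  [&& [forall v in O, m v == 0%N],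
      [forall v : 'I_n, 0 <= rate O m v]
    & rate O m n.-1 == 0].

(* The values of [m] are bounded by [n] to make the sum finite; no closed flow
   is lost, by [closed_flow_le]. *)
Definition ca (n : nat) : {poly int} :=
  \sum_(O : {set 'I_n})
    \sum_(m : {ffun 'I_n -> 'I_n.+1} | closed_flow O (fun v => m v : nat))
      'X^#|O|.

Lemma rate_sum n (O : {set 'I_n}) (m : 'I_n -> nat) k :
  rate O m k = \sum_(j < k.+1) net O m j.
Proof.
elim: k => [|k IHk] /=; first by rewrite big_ord1 addr0.
by rewrite big_ord_recr /= -IHk addrC.
Qed.

Lemma closed_flow_le n (O : {set 'I_n}) (m : 'I_n -> nat) (v : 'I_n) :
  closed_flow O m -> (m v <= n)%N.
Proof.
case: n O m v => [|n] O m v; first by case: v.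
case/and3P=> _ _; rewrite rate_sum /=.
rewrite (eq_bigr (fun j => (m j)%:Z - (j \in O : nat)%:Z)); last first.
  by move=> j _; rewrite /net valK.
rewrite sumrB subr_eq0 => /eqP.
rewrite -!(big_morph Posz PoszD (erefl _)) => -[E].
apply: (@leq_trans (\sum_i m i)%N); first by rewrite (bigD1 v) //= leq_addr.
rewrite E; apply: (@leq_trans (\sum_(i < n.+1) 1)%N).
  by apply: leq_sum => i _; case: (i \in O).
by rewrite sum_nat_const card_ord muln1.
Qed.

(* Noncommutative formal power series over [Z[b]], as coefficient functions on
   words; the indeterminate ['X] of [{poly int}] plays the role of [b]. *)

Definition letter := bool.
Definition lp : letter := false.
Definition lm : letter := true.

Definition series := seq letter -> {poly int}.

Definition series_one : series := fun w => (w == [::])%:R.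

Definition series_mul (A B : series) : series :=
  fun w => \sum_(i < (size w).+1) A (take i w) * B (drop i w).

Definition series_exp (A : series) (k : nat) : series :=
  iter k (series_mul A) series_one.

Definition serP : series := fun w =>
  if (0 < size w)%N && (w == nseq (size w) lp) then ca (size w) else 0.

Definition serN : series := fun w =>
  if (0 < size w)%N && (w == nseq (size w) lm)
  then (-1) ^+ size w * ca (size w) else 0.

(* The infinite sum over [k] is locally finite: by [series_exp_PN_eq0] only
   the terms with [k <= size w] contribute to the coefficient of [w]. *)
Definition serT : series := fun w =>
  \sum_(k < (size w).+1) 'X^k * series_exp (series_mul serP serN) k w.

Definition serF : series := fun w =>
  - series_mul (series_mul serN serT) serP w.

Lemma series_exp_PN_eq0 (k : nat) (w : seq letter) :
  (size w < k)%N -> series_exp (series_mul serP serN) k w = 0.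
Proof.
elim: k w => [//|k IHk] w lt_wk; rewrite /series_exp iterS -/(series_exp _ k).
rewrite /series_mul big1 // => -[[|i] /= lt_i] _.
  by rewrite take0 big_ord1 /serP /= mul0r mul0r.
rewrite [X in _ * X]IHk ?mulr0 // size_drop.
case: w lt_wk lt_i => [|a w] //= lt_wk _.
by rewrite subSS (leq_ltn_trans (leq_subr _ _)).
Qed.

(* The group ring [A[S_n]], as [A]-valued functions on ['S_n]; [A^o] provides
   the scaling [*:] by elements of [A].  ['S_n] composes
   permutations from left to right; the opposite convention would give the
   opposite product, hence the same squares. *)

Definition group_ring (A : comNzRingType) (n : nat) := {ffun 'S_n -> A^o}.

Definition gr_mul (A : comNzRingType) n (x y : group_ring A n) :
    group_ring A n :=
  [ffun u => \sum_(st : 'S_n * 'S_n | (st.1 * st.2)%g == u) x st.1 * y st.2].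

Definition one_line n (s : 'S_n) : seq nat := [seq val (s i) | i <- enum 'I_n].

Definition descent_word n (s : 'S_n) : seq letter :=
  mkseq (fun i => if (nth 0 (one_line s) i.+1 < nth 0 (one_line s) i)%N
                  then lm else lp) n.-1.

Definition ratp (f : {poly int}) : {poly rat} := map_poly intr f.

Definition compF (n : nat) : group_ring {poly rat} n :=
  [ffun s : 'S_n => ratp (serF (lm :: rcons (descent_word s) lp))].

(* Main.v *)
Require Import Defs.
From mathcomp Require Import all_boot all_order all_algebra all_fingroup.
From mathcomp Require Import zify ring.
Set Implicit Arguments.
Unset Strict Implicit.
Unset Printing Implicit Defensive.
Import Order.TTheory GRing.Theory Num.Theory.
Local Open Scope ring_scope.

(** Why the identity holds.

    Write [m phi p] for the series [- N T P], so that [phi] carries the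
    coefficients of [F].  Let [C] be the generating series of the Narayana
    polynomials in one variable [t].  Cutting a flow at the root of the chain
    gives [C = t (1 + C) (1 + b C)] (lemmas [flowsS] and [flows_coef]), hence
    [phi = E T D] with [D = (1 + P) (1 + b P)], [E = (1 + N) (1 + b N)] and
    [T] the inverse of [1 - b P N].

    The heart of the matter is that [F] is a Lie element.  By Ree's criterion
    this means that [phi], as a function of the descents of a word with distinct
    letters, sums to zero over the shuffles of two nonempty words [y] and [z]
    (lemma [shuffle_phi]).  Only the descents of [y] and [z] matter in such a sum
    ([sum_shuffle_swap]), so the letters of [y] may be taken smaller than those
    of [z].  The descents of a shuffle are then produced by an automaton with
    two states, according to which of the words was read last: reading a
    shuffle amounts to evaluating [phi] at two-by-two matrices whose entries
    involve letters for [z] and, commuting with them, letters for [y].  One of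
    these matrices is lower triangular, the other upper triangular, so that
    [C] is applied to them by divided differences, which the equation of [C]
    makes rational in [P] and [N].  What remains is a linear system of size two
    over a noncommutative ring, whose solution is explicit ([phi_hat_ones]).
    Series are evaluated at nilpotent matrices, where all sums are finite and
    coefficients are read off as entries.

    A Lie element [F] satisfies [S F = 0] for every product [S] of at least two
    complete functions, that is, for every sum of permutations whose
    coefficients ignore one of the descents ([sum_ignoring_descent_eq0]).
    Modulo such sums, a function of the descents is concentrated at the identity
    permutation, with the alternating sum of its values as coefficient
    ([sum_permutations_phi]).  Therefore [F F] is [F] times the sum of [phi]
    with the sign given by the number of letters [m].  This sum is a coefficient
    of [phi] at [p = t], [m = - t], where [P] and [N] both become [C]: it is
    [(1 + C)^2 (1 + b C)^2 / (1 - b C^2)], which is the derivative of [C]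
    ([narayana_deriv]), whence the factor [n ca_n] ([alternating_phi]). *)

(** * Identities between noncommutative polynomials *)

Inductive ncexp :=
| NCvar of nat
| NCzero
| NCone
| NCadd of ncexp & ncexp
| NCopp of ncexp
| NCmul of ncexp & ncexp.

Definition ncpoly := seq (int * seq nat).

Section NCNorm.

Variables (cen : seq nat) (prs : seq (nat * nat)).

Definition nc_com (i j : nat) : bool :=
  [|| i \in cen, j \in cen, (i, j) \in prs | (j, i) \in prs].

Fixpoint nc_insert (i : nat) (w : seq nat) : seq nat :=
  if w is j :: w' then
    if (j < i)%N && nc_com i j then j :: nc_insert i w' else i :: w
  else [:: i].

Definition nc_wmul (u w : seq nat) : seq nat := foldr nc_insert w u.

Fixpoint nc_norm (e : ncexp) : ncpoly :=
  match e with
  | NCvar i => [:: (1, [:: i])]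
  | NCzero => [::]
  | NCone => [:: (1, [::])]
  | NCadd e1 e2 => nc_norm e1 ++ nc_norm e2
  | NCopp e1 => [seq (- t.1, t.2) | t <- nc_norm e1]
  | NCmul e1 e2 =>
      [seq (t.1 * s.1, nc_wmul t.2 s.2) | t <- nc_norm e1, s <- nc_norm e2]
  end.

Definition nc_coef (w : seq nat) (p : ncpoly) : int :=
  foldr (fun t c => if t.2 == w then t.1 + c else c) 0 p.

Fixpoint nc_iszero (k : nat) (p : ncpoly) : bool :=
  match k, p with
  | _, [::] => true
  | 0, _ => false
  | k'.+1, t :: p' =>
      (nc_coef t.2 p == 0) && nc_iszero k' [seq s <- p' | s.2 != t.2]
  end.

Definition nc_decide (e1 e2 : ncexp) : bool :=
  let p := nc_norm (NCadd e1 (NCopp e2)) in nc_iszero (size p) p.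

Variables (A : nzRingType) (env : seq A).

Fixpoint nc_eval (e : ncexp) : A :=
  match e with
  | NCvar i => nth 0 env i
  | NCzero => 0
  | NCone => 1
  | NCadd e1 e2 => nc_eval e1 + nc_eval e2
  | NCopp e1 => - nc_eval e1
  | NCmul e1 e2 => nc_eval e1 * nc_eval e2
  end.

Definition nc_mon (w : seq nat) : A := \prod_(i <- w) nth 0 env i.
Definition nc_term (t : int * seq nat) : A := nc_mon t.2 *~ t.1.

Definition nc_central : Prop :=
  foldr (fun i P => (forall z, GRing.comm (nth 0 env i) z) /\ P) True cen.
Definition nc_pairs : Prop :=
  foldr (fun ij P => GRing.comm (nth 0 env ij.1) (nth 0 env ij.2) /\ P)
    True prs.

Hypotheses (cenP : nc_central) (prsP : nc_pairs).

Lemma nc_comP i j : nc_com i j -> GRing.comm (nth 0 env i) (nth 0 env j).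
Proof.
have cen_in k z : k \in cen -> GRing.comm (nth 0 env k) z.
  move: cenP; rewrite /nc_central; elim: cen => //= a s IHs [ca cs].
  by rewrite inE => /predU1P[-> //|/IHs]; exact.
have prs_in k l : (k, l) \in prs -> GRing.comm (nth 0 env k) (nth 0 env l).
  move: prsP; rewrite /nc_pairs; elim: prs => //= a s IHs [ca cs].
  by rewrite inE => /predU1P[e|/IHs]; [move: ca; rewrite -e | exact].
by case/or4P=> [/cen_in|/cen_in ci|/prs_in|/prs_in/commr_sym] //; apply/commr_sym.
Qed.

Lemma nc_insertE i w : nc_mon (nc_insert i w) = nth 0 env i * nc_mon w.
Proof.
rewrite /nc_mon; elim: w => [|j w IHw] /=; first by rewrite big_seq1 big_nil mulr1.
case: ifP => [/andP[_ /nc_comP cij]|_]; last by rewrite !big_cons.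
by rewrite !big_cons IHw !mulrA cij.
Qed.

Lemma nc_wmulE u w : nc_mon (nc_wmul u w) = nc_mon u * nc_mon w.
Proof.
elim: u => [|i u IHu] /=; first by rewrite {2}/nc_mon big_nil mul1r.
by rewrite nc_insertE IHu mulrA /nc_mon big_cons.
Qed.

Lemma nc_normE e : nc_eval e = \sum_(t <- nc_norm e) nc_term t.
Proof.
elim: e => [i|||e1 IH1 e2 IH2|e IH|e1 IH1 e2 IH2] /=.
- by rewrite big_seq1 /nc_term /nc_mon big_seq1.
- by rewrite big_nil.
- by rewrite big_seq1 /nc_term /nc_mon big_nil.
- by rewrite big_cat IH1 IH2.
- by rewrite big_map IH -sumrN; apply: eq_bigr => t _; rewrite /nc_term mulrNz.
rewrite IH1 IH2 big_allpairs_dep mulr_suml; apply: eq_bigr => t _.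
rewrite mulr_sumr; apply: eq_bigr => s _.
by rewrite /nc_term /= nc_wmulE mulrzAl mulrzAr mulrzA_C.
Qed.

Lemma nc_coefE w p :
  \sum_(t <- p | t.2 == w) nc_term t = nc_mon w *~ nc_coef w p.
Proof.
elim: p => [|t p IHp]; first by rewrite big_nil.
by rewrite big_cons /= IHp; case: eqP => // <-; rewrite mulrzDr.
Qed.

Lemma nc_iszeroP k p : nc_iszero k p -> \sum_(t <- p) nc_term t = 0.
Proof.
elim: k p => [|k IHk] [|t p] //=; rewrite ?big_nil // => /andP[/eqP c0 /IHk].
rewrite big_filter => IH; rewrite (bigID (fun s => s.2 == t.2)) /=.
by rewrite nc_coefE [nc_coef _ _]c0 mulr0z add0r big_cons eqxx.
Qed.

Lemma nc_decideP e1 e2 : nc_decide e1 e2 -> nc_eval e1 = nc_eval e2.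
Proof.
move/nc_iszeroP; rewrite -nc_normE /= => /eqP.
by rewrite subr_eq0 => /eqP.
Qed.

End NCNorm.

Ltac nc_index x env :=
  lazymatch env with
  | x :: _ => constr:(0%N)
  | _ :: ?env' => let i := nc_index x env' in constr:(i.+1)
  end.

Ltac nc_add x env :=
  lazymatch env with
  | x :: _ => env
  | ?y :: ?env' => let env'' := nc_add x env' in constr:(y :: env'')
  | _ => constr:(x :: env)
  end.

Ltac nc_atoms e env :=
  lazymatch e with
  | ?a + ?b => let env := nc_atoms a env in nc_atoms b env
  | ?a * ?b => let env := nc_atoms a env in nc_atoms b env
  | - ?a => nc_atoms a env
  | 0 => env
  | 1 => env
  | _ => nc_add e env
  end.

Ltac nc_add_new x env :=
  lazymatch env with
  | context [x :: _] => fail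
  | _ => nc_add x env
  end.

(* Every word can be normalized by bubbling only if commuting classes are kept
   together: central atoms are numbered first, then the left members of the
   commutation hypotheses. *)
Ltac nc_centrals T env :=
  match goal with
  | _ : forall z, GRing.comm ?x z |- _ =>
      let _ := constr:(x : T) in
      let env := nc_add_new x env in nc_centrals T env
  | _ => env
  end.

Ltac nc_lefts T env :=
  match goal with
  | _ : GRing.comm ?x _ |- _ =>
      let _ := constr:(x : T) in
      let env := nc_add_new x env in nc_lefts T env
  | _ => env
  end.

Ltac nc_reify e env :=
  lazymatch e with
  | ?a + ?b =>
      let a := nc_reify a env in let b := nc_reify b env in
      constr:(NCadd a b)
  | ?a * ?b =>
      let a := nc_reify a env in let b := nc_reify b env in
      constr:(NCmul a b)
  | - ?a => let a := nc_reify a env in constr:(NCopp a)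
  | 0 => constr:(NCzero)
  | 1 => constr:(NCone)
  | _ => let i := nc_index e env in constr:(NCvar i)
  end.

Ltac nc_add_cen i l :=
  lazymatch l with
  | context [i :: _] => fail
  | _ => constr:(i :: l)
  end.

Ltac nc_cen env l :=
  match goal with
  | _ : forall z, GRing.comm ?x z |- _ =>
      let i := nc_index x env in
      let l := nc_add_cen i l in
      nc_cen env l
  | _ => l
  end.

Ltac nc_add_prs i l :=
  lazymatch l with
  | context [i :: _] => fail
  | _ => constr:(i :: l)
  end.

Ltac nc_prs env l :=
  match goal with
  | _ : GRing.comm ?x ?y |- _ =>
      let i := nc_index x env in
      let j := nc_index y env in
      let l := nc_add_prs (i, j) l in
      nc_prs env l
  | _ => l
  end.

(** Decides an identity of noncommutative polynomials with integer
    coefficients, modulo the commutation relations among the hypotheses. *)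
Ltac ncring :=
  lazymatch goal with
  | |- @eq ?T ?x ?y =>
      let env := nc_centrals T (@nil T) in
      let env := nc_lefts T env in
      let env := nc_atoms x env in
      let env := nc_atoms y env in
      let cen := nc_cen env (@nil nat) in
      let prs := nc_prs env (@nil (nat * nat)) in
      let ex := nc_reify x env in
      let ey := nc_reify y env in
      refine (@nc_decideP cen prs _ env _ _ ex ey _);
      [ repeat split; assumption
      | repeat split; assumption
      | vm_compute; reflexivity ]
  end.

(** * Narayana polynomials *)

Section FfunRcons.
Variables (X : finType) (n : nat).

Definition ffun_rcons (g : {ffun 'I_n -> X}) (x : X) : {ffun 'I_n.+1 -> X} :=
  [ffun i => if unlift ord_max i is Some j then g j else x].

Lemma ffun_rcons_lift g x j : ffun_rcons g x (lift ord_max j) = g j.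
Proof. by rewrite ffunE liftK. Qed.

Lemma ffun_rcons_max g x : ffun_rcons g x ord_max = x.
Proof. by rewrite ffunE unlift_none. Qed.

Lemma sum_ffun_rcons (V : nmodType) (F : {ffun 'I_n.+1 -> X} -> V) :
  \sum_f F f = \sum_x \sum_g F (ffun_rcons g x).
Proof.
rewrite pair_big /= (reindex (fun xg => ffun_rcons xg.2 xg.1)) //=.
exists (fun f => (f ord_max, [ffun j => f (lift ord_max j)])) => [[x g] _|f _] /=.
  rewrite ffun_rcons_max; congr (_, _); apply/ffunP => j.
  by rewrite ffunE ffun_rcons_lift.
by apply/ffunP => i; rewrite ffunE; case: unliftP => [j|] ->; rewrite ?ffunE.
Qed.

End FfunRcons.

Lemma sum_set_ffun (T : finType) (V : nmodType) (F : {set T} -> V) :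
  \sum_(O : {set T}) F O = \sum_(f : {ffun T -> bool}) F [set x | f x].
Proof.
rewrite (reindex (fun f : {ffun T -> bool} => [set x | f x])) //=.
exists (fun O : {set T} => [ffun x => x \in O]) => [f _|O _].
  by apply/ffunP => x; rewrite ffunE inE.
by apply/setP => x; rewrite inE ffunE.
Qed.

Lemma netE n (O : {set 'I_n}) m (v : 'I_n) :
  net O m v = (m v)%:Z - (v \in O : nat)%:Z.
Proof. by rewrite /net valK. Qed.

Lemma rateE n (O : {set 'I_n}) m k :
  rate O m k = net O m k + if (0 < k)%N then rate O m k.-1 else 0.
Proof. by case: k. Qed.

Lemma rate_empty n (O : {set 'I_n}) m k : n = 0%N -> rate O m k = 0.
Proof.
move=> n0; rewrite rate_sum big1 // => j _; rewrite /net.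
by case: insubP => // v _ _; have := ltn_ord v; rewrite {2}n0.
Qed.

Section Flows.
Variable B : nat.

Definition flow_to n (O : {set 'I_n}) (m : 'I_n -> nat) (h : int) : bool :=
  [&& [forall v in O, m v == 0%N],
      [forall v : 'I_n, 0 <= rate O m v]
    & rate O m n.-1 == h].

(** The values of a flow are bounded by a fixed [B], because the bound has to
    survive the removal of the root. *)
Definition flows n (h : int) : {poly int} :=
  \sum_(f : {ffun 'I_n -> bool})
    \sum_(m : {ffun 'I_n -> 'I_B.+1} | flow_to [set x | f x] (fun v => m v : nat) h)
      'X^#|[set x | f x]|.

(** The value at the root is invisible from the other vertices, so cutting the
    root only shifts the rate that has to be reached. *)
Lemma flow_to_rcons n (f : {ffun 'I_n -> bool}) x (m : {ffun 'I_n -> 'I_B.+1}) k h :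
  flow_to [set i | ffun_rcons f x i] (fun v => ffun_rcons m k v : nat) h =
  [&& x ==> (k == 0), 0 <= h & flow_to [set i | f i] (fun v => m v : nat) (h - (k : nat)%:Z + (x : nat)%:Z)].
Proof.
set O := [set i | ffun_rcons f x i]; set O' := [set i | f i].
set mm := fun v => _ : nat; set mm' := fun v : 'I_n => m v : nat.
have net_lt j : (j < n)%N -> net O mm j = net O' mm' j.
  move=> lt_jn; have -> : j = lift ord_max (Ordinal lt_jn) by rewrite lift_max.
  by rewrite netE /mm ffun_rcons_lift inE ffun_rcons_lift lift_max /= -[j]/(val (Ordinal lt_jn)) netE inE.
have rate_lt j : (j < n)%N -> rate O mm j = rate O' mm' j.
  elim: j => [|j IHj] lt_jn /=; rewrite net_lt // IHj //; exact: ltnW.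
have rate_n : rate O mm n = (k : nat)%:Z - (x : nat)%:Z + rate O' mm' n.-1.
  have net_n : net O mm n = (k : nat)%:Z - (x : nat)%:Z.
    by rewrite -[n]/(val (@ord_max n)) netE /mm ffun_rcons_max inE ffun_rcons_max.
  rewrite rateE net_n; case: ltnP => [n_gt0|]; first by rewrite rate_lt ?prednK.
  by rewrite leqn0 => /eqP n0; rewrite rate_empty.
rewrite /flow_to /=.
have -> : [forall v in O, mm v == 0%N] =
    (x ==> (k == 0)) && [forall v in O', mm' v == 0%N].
  apply/forall_inP/andP => [allO|[/implyP k0 /forall_inP allO'] v].
    split; first by apply/implyP => x1; have := allO ord_max; rewrite inE /mm !ffun_rcons_max; apply.
    by apply/forall_inP => v; have := allO (lift ord_max v); rewrite !inE /mm !ffun_rcons_lift.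
  case: (unliftP ord_max v) => [j|] ->; rewrite inE /mm ?ffun_rcons_lift ?ffun_rcons_max //.
  by move=> fj; apply: allO'; rewrite inE.
have -> : [forall v : 'I_n.+1, 0 <= rate O mm v] =
    (0 <= rate O mm n) && [forall v : 'I_n, 0 <= rate O' mm' v].
  apply/forallP/andP => [all0|[ge0 /forallP all0'] v].
    split; first exact: (all0 ord_max).
    by apply/forallP => v; have := all0 (lift ord_max v); rewrite lift_max rate_lt.
  case: (unliftP ord_max v) => [j|] -> //.
  by rewrite lift_max rate_lt.
rewrite rate_n; set r := rate O' _ _.
have -> : (k%:Z - x%:Z + r == h) = (r == h - k%:Z + x%:Z).
  by apply/eqP/eqP => [<-|->]; ring.
case: (x ==> _); case: [forall v in O', _]; case: [forall v, _]; rewrite ?andbF //=.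
by case: eqP => [->|]; rewrite ?andbF // !andbT; congr (0 <= _); ring.
Qed.

Lemma flows0 h : flows 0 h = (h == 0)%:R.
Proof.
have F0 (X : finType) (g g' : {ffun 'I_0 -> X}) : g = g' by apply/ffunP; case.
pose f0 : {ffun 'I_0 -> bool} := [ffun=> false].
pose m0 : {ffun 'I_0 -> 'I_B.+1} := [ffun=> ord0].
rewrite /flows (big_pred1 f0) => [|f]; last by rewrite (F0 _ f f0) /= eqxx.
have -> : #|[set x | f0 x]| = 0%N by apply: eq_card0 => -[].
rewrite big_mkcond (big_pred1 m0) => [|m]; last by rewrite (F0 _ m m0) /= eqxx.
rewrite /flow_to rate_empty // eq_sym expr0.
have -> : [forall v in [set x | f0 x], (m0 v : nat) == 0%N] by apply/forallP => -[].
have -> : [forall v : 'I_0, 0 <= rate [set x | f0 x] (fun v => m0 v : nat) v] by apply/forallP => -[].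
by case: eqP.
Qed.

Lemma flows_lt0 n h : h < 0 -> flows n h = 0.
Proof.
move=> h_lt0; case: n => [|n]; first by rewrite flows0 (lt_eqF h_lt0).
rewrite /flows big1 // => f _; rewrite big1 // => m /and3P[_ /forallP/(_ ord_max) ge0 /eqP eh].
by move: ge0; rewrite /= in eh *; rewrite eh leNgt h_lt0.
Qed.

Lemma card_rcons n (f : {ffun 'I_n -> bool}) x :
  #|[set i | ffun_rcons f x i]| = (x + #|[set i | f i]|)%N.
Proof.
rewrite -!sum1_card !(big_mkcond (fun i => i \in _)) /= big_ord_recr addnC /=.
rewrite inE ffun_rcons_max; congr (_ + _)%N.
apply: eq_bigr => i _; rewrite !inE.
have -> : widen_ord (leqnSn n) i = lift ord_max i by apply: ord_inj; rewrite lift_max.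
by rewrite ffun_rcons_lift.
Qed.

(** An output root is fed at rate [h + 1]; a root of value [k] that is not an
    output is fed at rate [h - k]. *)
Lemma flowsS n (h : nat) : (h <= B)%N ->
  flows n.+1 h%:Z = \sum_(j < h.+1) flows n j%:Z + 'X * flows n h.+1%:Z.
Proof.
move=> le_hB.
have -> : flows n.+1 h%:Z = \sum_(x : bool) \sum_(k < B.+1 | x ==> (k == 0))
    'X^x * flows n (h%:Z - (k : nat)%:Z + (x : nat)%:Z).
  rewrite {1}/flows sum_ffun_rcons; apply: eq_bigr => x _.
  under eq_bigr do rewrite big_mkcond sum_ffun_rcons.
  rewrite exchange_big /= [RHS]big_mkcond; apply: eq_bigr => k _.
  case: ifP => xk; last first.
    by apply: big1 => f _; apply: big1 => m _; rewrite flow_to_rcons xk.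
  rewrite /flows mulr_sumr; apply: eq_bigr => f _.
  rewrite mulr_sumr [RHS]big_mkcond; apply: eq_bigr => m _.
  by rewrite flow_to_rcons xk /= card_rcons exprD.
rewrite big_bool /= addrC; congr (_ + _); last first.
  by rewrite big_pred1_eq subr0 expr1 -PoszD addn1.
under eq_bigr do rewrite expr0 mul1r addr0.
rewrite (bigID (fun k : 'I_B.+1 => (k < h.+1)%N)) /= addrC big1 => [|k]; last first.
  rewrite -leqNgt => lt_hk; apply: flows_lt0; lia.
rewrite add0r -(big_ord_widen _ (fun k => flows n (h%:Z - k%:Z))) //.
rewrite (reindex_inj rev_ord_inj) /=; apply: eq_bigr => j _.
by congr flows; have := ltn_ord j; lia.
Qed.
End Flows.

Lemma caE n : ca n = flows n n 0.
Proof. by rewrite /ca sum_set_ffun. Qed.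

(** Successive approximations of the solution of [C = t (1 + C) (1 + b C)];
    here ['X] is [t] and ['X%:P] is [b]. *)
Fixpoint narayana_approx (k : nat) : {poly {poly int}} :=
  if k is k'.+1 then
    'X * (1 + narayana_approx k') * (1 + 'X%:P * narayana_approx k')
  else 0.

(** The error gains a factor ['X] at each step, because the right-hand side of
    the equation is divisible by ['X]. *)
Lemma narayana_approxP k : exists r,
  'X * (1 + narayana_approx k) * (1 + 'X%:P * narayana_approx k)
  = narayana_approx k + 'X^k * r.
Proof.
suff [r er] : exists r, narayana_approx k.+1 = narayana_approx k + 'X^k * r by exists r.
elim: k => [|k [r IHk]]; first by exists (narayana_approx 1); rewrite add0r mul1r.
exists (r * (1 + 'X%:P + 'X%:P * (narayana_approx k + narayana_approx k.+1))).
have e k' : narayana_approx k'.+1 = 'X * (1 + narayana_approx k') * (1 + 'X%:P * narayana_approx k') by [].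
rewrite (e k.+1) {3}(e k) IHk exprS; ring.
Qed.

Lemma coef_XnM_lt (R : nzRingType) (r : {poly R}) n k : (n < k)%N -> ('X^k * r)`_n = 0.
Proof. by move=> lt_nk; rewrite coefXnM lt_nk. Qed.

(** Flows ending at rate [h] have generating series [C (1 + C)^h], up to the
    empty chain: the partial sums over [j <= h] are [(1 + C)^(h + 1)], so that
    the recurrence [flowsS] becomes the equation of [C]. *)
Lemma flows_coef k B n (h : nat) : (n < k)%N -> (h + n <= B)%N ->
  let C := narayana_approx k in
  flows B n h%:Z = (C * (1 + C) ^+ h)`_n + ((n == 0%N) && (h == 0%N))%:R.
Proof.
move=> + + C; have [r Cr] := narayana_approxP k; rewrite -/C in Cr.
have C0 : C`_0 = 0.
  rewrite /C; case: (k) => [|k'] /=; first by rewrite coef0.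
  by rewrite -mulrA coefXM.
elim: n h => [|n IHn] h lt_nk le_hB.
  by rewrite flows0 coef0M C0 mul0r add0r eqz_nat.
rewrite flowsS; last by lia.
rewrite (eq_bigr (fun j : 'I_h.+1 => (C * (1 + C) ^+ j)`_n + ((n == 0%N) && (j == 0 :> nat))%:R)); last first.
  by move=> j _; rewrite IHn //; have := ltn_ord j; lia.
rewrite IHn /= ?andbF ?addr0; [|lia|lia].
rewrite big_split /= -coef_sum -mulr_sumr.
have -> : \sum_(j < h.+1) ((n == 0%N) && (j == 0 :> nat))%:R = (1 : {poly {poly int}})`_n.
  rewrite big_ord_recl big1 /= => [|j _]; last by rewrite andbF.
  by rewrite andbT addr0 coef1.
have -> : C * (\sum_(j < h.+1) (1 + C) ^+ j) = (1 + C) ^+ h.+1 - 1.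
  by rewrite subrX1; congr (_ * _); ring.
rewrite -coefD subrK -coefCM -coefD.
have -> : (1 + C) ^+ h.+1 + 'X%:P * (C * (1 + C) ^+ h.+1) = (1 + C) * (1 + 'X%:P * C) * (1 + C) ^+ h.
  by rewrite exprS; ring.
set u := _ * (1 + C) ^+ h; have -> : u`_n = ('X * u)`_n.+1 by rewrite coefXM.
have -> : 'X * u = C * (1 + C) ^+ h + 'X^k * (r * (1 + C) ^+ h).
  by rewrite /u !mulrA Cr; ring.
by rewrite coefD coef_XnM_lt // addr0.
Qed.

Lemma narayana_approx_coef k n : (n < k)%N ->
  (narayana_approx k)`_n = if n == 0%N then 0 else ca n.
Proof.
move=> lt_nk; case: eqP => [->|/eqP n_neq0].
  by case: k lt_nk => [//|k] _ /=; rewrite -mulrA coefXM.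
have := @flows_coef k n n 0 lt_nk (leqnn _); rewrite /=.
by rewrite expr0 mulr1 -caE (negPf n_neq0) addr0 => ->.
Qed.

(** * The algebra of a Narayana pair *)

(** The relations satisfied by [P = C(p)], [N = C(- m)], [D = C(p) / p],
    [E = C(- m) / (- m)] and the inverse [T] of [1 - b P N].  They are all that
    primitivity uses, so they are isolated from the series. *)
Record narayana_pair (A : nzRingType) (b p m P N D E T : A) : Prop := NarayanaPair {
  np_pD : P = p * D;
  np_Dp : P = D * p;
  np_D : D = 1 + P + b * P + b * P * P;
  np_mE : N = - (m * E);
  np_Em : N = - (E * m);
  np_E : E = 1 + N + b * N + b * N * N;
  np_T1 : T * (1 - b * P * N) = 1;
  np_1T : (1 - b * P * N) * T = 1 }.

Lemma eq_of_sub_eq (A : zmodType) (x y z : A) : x - y = z -> z = 0 -> x = y.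
Proof. by move=> <- /eqP; rewrite subr_eq0 => /eqP. Qed.

Section Pair.
Variables (A : nzRingType) (b p m P N D E T : A).
Hypothesis cb : forall z, GRing.comm b z.
Hypothesis np : narayana_pair b p m P N D E T.

(** The inverse of [E T], written without inverses: it is linear in [N] and
    [P] because [N E^-1 = - m]. *)
Definition np_ETinv := 1 + m + b * m + b * (N + P) * m.

Lemma np_Dinv : D * (1 - p - b * p - b * P * p) = 1.
Proof.
case: np => ? PD eD *.
have cPD : D * P = P * D by rewrite eD; ncring.
have -> : D * (1 - p - b * p - b * P * p) = D - D * p - b * (D * p) - b * (D * P) * p by ncring.
rewrite -PD cPD -!mulrA -PD eD; ncring.
Qed.

Lemma np_invD : (1 - p - b * p - b * P * p) * D = 1.
Proof.
case: np => pD PD eD *.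
have -> : (1 - p - b * p - b * P * p) * D = D - p * D - b * (p * D) - b * P * (p * D) by ncring.
rewrite -pD eD; ncring.
Qed.

Lemma np_invE : (1 + m + b * m + b * N * m) * E = 1.
Proof.
case: np => _ _ _ mE _ eE *.
have mE' : m * E = - N by rewrite mE opprK.
have -> : (1 + m + b * m + b * N * m) * E = E + m * E + b * (m * E) + b * N * (m * E) by ncring.
rewrite mE' {1}eE; ncring.
Qed.

Lemma np_Einv : E * (1 + m + b * m + b * N * m) = 1.
Proof.
case: np => _ _ _ mE Em eE *.
have Em' : E * m = - N by rewrite Em opprK.
have cNE : E * N = N * E by rewrite eE; ncring.
have -> : E * (1 + m + b * m + b * N * m) = E + E * m + b * (E * m) + b * (E * N) * m by ncring.
rewrite cNE -mulrA -[N * E * m]mulrA Em' {1}eE; ncring.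
Qed.

Lemma np_ETinvE : (1 - b * P * N) * (1 + m + b * m + b * N * m) = np_ETinv.
Proof.
have NEi : N * (1 + m + b * m + b * N * m) = - m.
  by rewrite {1}(np_mE np) mulNr -[m * E * _]mulrA np_Einv mulr1.
rewrite mulrBl mul1r -[b * P * N * _]mulrA NEi /np_ETinv; ncring.
Qed.

Lemma np_ET_ETinv : E * T * np_ETinv = 1.
Proof. by rewrite -np_ETinvE !mulrA -[E * T * _]mulrA (np_T1 np) mulr1 np_Einv. Qed.

Lemma np_ETinv_ET : np_ETinv * E * T = 1.
Proof.
by rewrite -np_ETinvE -[_ * _ * E]mulrA np_invE mulr1 (np_1T np).
Qed.

(** For [phi = E T D] and [q = p + m], the last relation amounts to
    [phi q phi = phi P - N phi].  It rests on the factorization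
    [q = D^-1 (P T^-1 - T^-1 N) E^-1], whose middle term is [P E - D N]. *)
Lemma np_conj : let Phi := (1 - p - b * p - b * P * p) * np_ETinv in
  [/\ Phi * (E * T * D) = 1, D * Phi = np_ETinv & P * Phi = Phi * N + (p + m)].
Proof.
move=> Phi; split.
- by rewrite /Phi !mulrA -[_ * np_ETinv * E]mulrA -[_ * (_ * _) * T]mulrA np_ETinv_ET mulr1 np_invD.
- by rewrite /Phi mulrA np_Dinv mul1r.
have [pD PD eD mE Em eE _ _] := np.
have DiP : (1 - p - b * p - b * P * p) * P = p.
  by rewrite {2}PD [_ * (D * p)]mulrA np_invD mul1r.
have PDi : P * (1 - p - b * p - b * P * p) = p.
  by rewrite {1}pD -[p * D * _]mulrA np_Dinv mulr1.
have EiN : (1 + m + b * m + b * N * m) * N = - m.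
  by rewrite {2}Em mulrN [_ * (E * m)]mulrA np_invE mul1r.
have key : P * (1 - b * P * N) - (1 - b * P * N) * N = P * E - D * N.
  rewrite eE eD; ncring.
rewrite /Phi -np_ETinvE; set K := 1 - p - _ - _ in DiP PDi *.
set L := 1 + m + _ + _ in EiN *.
have cPK : P * K = K * P by rewrite DiP PDi.
have cLN : L * N = N * L by rewrite EiN {1}mE mulNr -[m * E * _]mulrA np_Einv mulr1.
set S := 1 - b * P * N in key *.
have -> : K * (S * L) * N = K * S * (L * N) by ncring.
rewrite cLN !mulrA cPK.
apply/eqP; rewrite addrC -subr_eq; apply/eqP.
transitivity (K * (P * S - S * N) * L); first by ncring.
rewrite key.
transitivity (K * P * (E * L) - (K * D) * (L * N)).
  by rewrite cLN; ncring.
by rewrite np_Einv np_invD EiN DiP; ncring.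
Qed.
End Pair.

(** * Two-by-two matrices *)

Definition mx2 (A : nzRingType) (a b c d : A) : 'M[A]_2 :=
  \matrix_(i, j) if i == 0 then if j == 0 then a else b
                 else if j == 0 then c else d.
Definition col2 (A : nzRingType) (a b : A) : 'cV[A]_2 :=
  \col_i if i == 0 then a else b.

Section Mx2.
Variable A : nzRingType.
Implicit Types a b c d x y : A.

Lemma scalar_mx_central n (b : A) : (forall z, GRing.comm b z) ->
  forall z : 'M[A]_n.+1, GRing.comm b%:M z.
Proof.
move=> cb z; apply/matrixP => i j.
by rewrite -!mulmxE -diag_const_mx mul_diag_mx mul_mx_diag !mxE cb.
Qed.

Lemma eq_mx2 (M N : 'M[A]_2) :
  M 0 0 = N 0 0 -> M 0 1 = N 0 1 -> M 1 0 = N 1 0 -> M 1 1 = N 1 1 -> M = N.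
Proof.
move=> e00 e01 e10 e11; apply/matrixP.
have I2 (i : 'I_2) : i = 0 \/ i = 1.
  by case: i => -[|[|//]] lt_i; [left | right]; apply: val_inj.
by move=> i j; case: (I2 i) => ->; case: (I2 j) => ->.
Qed.

Lemma mx2_inj a b c d a' b' c' d' : mx2 a b c d = mx2 a' b' c' d' ->
  [/\ a = a', b = b', c = c' & d = d'].
Proof.
by move=> /matrixP e; split; [have:= e 0 0 | have:= e 0 1 | have:= e 1 0 | have:= e 1 1];
  rewrite !mxE.
Qed.

Lemma mx2M a b c d a' b' c' d' : mx2 a b c d * mx2 a' b' c' d' =
  mx2 (a * a' + b * c') (a * b' + b * d') (c * a' + d * c') (c * b' + d * d').
Proof. by apply: eq_mx2; rewrite !mxE !big_ord_recl big_ord0 !mxE /= addr0. Qed.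

Lemma mx2D a b c d a' b' c' d' :
  mx2 a b c d + mx2 a' b' c' d' = mx2 (a + a') (b + b') (c + c') (d + d').
Proof. by apply: eq_mx2; rewrite !mxE. Qed.

Lemma mx2N a b c d : - mx2 a b c d = mx2 (- a) (- b) (- c) (- d).
Proof. by apply: eq_mx2; rewrite !mxE. Qed.

Lemma mx2_scal a : a%:M = mx2 a 0 0 a.
Proof. by apply: eq_mx2; rewrite !mxE. Qed.

Lemma mx2_1 : 1 = mx2 1 0 0 1 :> 'M[A]_2.
Proof. by rewrite -mx2_scal. Qed.

Lemma mx2_col a b c d x y :
  mx2 a b c d *m col2 x y = col2 (a * x + b * y) (c * x + d * y).
Proof.
by apply/colP => i; rewrite !mxE !big_ord_recl big_ord0 !mxE /= addr0; case: eqP.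
Qed.

End Mx2.

Definition mx2E := (mx2_scal, mx2_1, mx2N, mx2M, mx2D, mulr0, mul0r, mulr1, mul1r,
   addr0, add0r, oppr0).

(** * Primitivity *)

(** The unprimed letters are the gaps of a word [z], the primed ones those of a
    word [y] with smaller letters.  The two rows of a matrix stand for the last
    word read, [z] first.  Reading on in the same word emits the gap of that
    word; passing from [z] to [y] is a descent, so it occurs in the matrix of [m]
    only, and the gap of [y] that it bridges may be of either kind, hence the
    entry [q']; passing back is an ascent and has the entry [q] in the matrix of
    [p]. *)
Section Primitive.
Variables (A : nzRingType) (b : A).
Variables (p m P N D E T p' m' P' N' D' E' T' x y : A).
Variables (Dh Eh Th : 'M[A]_2).
Hypothesis cb : forall z, GRing.comm b z.
Hypothesis np : narayana_pair b p m P N D E T.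
Hypothesis np' : narayana_pair b p' m' P' N' D' E' T'.
Hypothesis comm_vu : {in [:: p; m; P; N; D; E; T] & [:: p'; m'; P'; N'; D'; E'; T'],
  forall v u, GRing.comm v u}.

Let q : A := p + m.
Let q' : A := p' + m'.

Hypothesis nph : narayana_pair b%:M (mx2 p 0 q p') (mx2 m q' 0 m')
  (mx2 P 0 x P') (mx2 N y 0 N') Dh Eh Th.
Hypothesis xP' : GRing.comm x P'.
Hypothesis Ny : GRing.comm N y.

Ltac vu := apply: comm_vu; rewrite !inE eqxx ?orbT.

Let xQ : A := x * (1 + b + b * P + b * P').

Lemma hat_D_entries : Dh = mx2 D 0 xQ D'.
Proof.
rewrite (np_D nph) !mx2E (np_D np) (np_D np') /xQ.
by congr mx2; ncring.
Qed.

Lemma hat_E_entries : Eh = mx2 E (y + b * y + b * (N * y + y * N')) 0 E'.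
Proof.
rewrite (np_E nph) !mx2E (np_E np) (np_E np').
by congr mx2; ncring.
Qed.

(** The corner of [C] at a lower triangular matrix is a divided difference.
    The equation of [C] turns division by [p' - p], which makes no sense for
    nilpotent letters, into division by [1 - b P' P]. *)
Lemma hat_lower_cornerE : x * (1 - b * P' * P) = D' * q * D.
Proof.
have := np_Dp nph; rewrite hat_D_entries !mx2E => /mx2_inj[_ _ ex _].
have e1 : x * (1 - p - b * p - b * P * p) - b * P' * x * p = D' * q.
  by apply: (@eq_of_sub_eq _ _ _ (x - (xQ * p + D' * q))); [rewrite /xQ; ncring | rewrite -ex subrr].
rewrite -e1 mulrBl -[x * _ * D]mulrA (np_invD cb np) mulr1 -[_ * p * D]mulrA -(np_pD np).
ncring.
Qed.

Lemma hat_upper_cornerE : y * (1 - b * N * N') = - (E * q' * E').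
Proof.
have := np_Em nph; rewrite hat_E_entries !mx2E => /mx2_inj[_ ey _ _].
have e1 : y * (1 + m' + b * m' + b * N' * m') + b * N * y * m' = - (E * q').
  by apply: (@eq_of_sub_eq _ _ _ (y - - (E * q' + (y + b * y + b * (N * y + y * N')) * m'))); [ncring | rewrite -ey subrr].
rewrite -[- (_ * E')]mulNr -e1 mulrDl -[y * _ * E']mulrA (np_invE cb np') mulr1 -[_ * m' * E']mulrA.
have -> : m' * E' = - N' by rewrite (np_mE np') opprK.
ncring.
Qed.

Variables (Y Z : A).
Hypothesis Y1 : Y * (1 - b * N * N') = 1.
Hypothesis Y2 : (1 - b * N * N') * Y = 1.
Hypothesis Z1 : (1 - b * N' * P) * Z = 1.

Let phi : A := E * T * D.
Let phi' : A := E' * T' * D'.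
Let G : A := 1 + b + b * P + b * N * T * D.
Let W : A := 1 - b * N * P.
(* [beta] is found by inserting the shape [phi + q' D beta] of the first entry
   into the first row of the system for the column [phi (1, 1)]. *)
Let beta : A := - (Z * (b * N' + G) * phi').

Lemma W_G : W * G = 1 + b + b * (N + P).
Proof.
have WNT : W * N * T = N.
  have -> : W * N = N * (1 - b * P * N) by rewrite /W; ncring.
  by rewrite -[N * _ * T]mulrA (np_1T np) mulr1.
have cPD : P * D = D * P by rewrite {1}(np_Dp np) -[D * p * D]mulrA -(np_pD np).
apply: (@eq_of_sub_eq _ _ _ (b * (W * N * T - N) * D + b * N * (D - (1 + P + b * P + b * P * P)))).
  rewrite /G /W; ncring.
by rewrite WNT -(np_D np) !subrr; ncring.
Qed.

Lemma beta_eq : (1 - b * N' * P) * beta = - ((b * N' + G) * phi').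
Proof. by rewrite /beta mulrN !mulrA Z1 mul1r. Qed.

Lemma m_phiE : m * phi = - (N * T * D).
Proof. by rewrite /phi !mulrA -mulNr -mulNr (np_mE np) opprK. Qed.

Lemma ETinv_phi : np_ETinv b m P N * phi = D.
Proof. by rewrite /phi !mulrA (np_ETinv_ET cb np) mul1r. Qed.

Lemma ETinv_phi' : np_ETinv b m' P' N' * phi' = D'.
Proof. by rewrite /phi' !mulrA (np_ETinv_ET cb np') mul1r. Qed.

Let aV : A := phi + q' * (D * beta).
Let aU : A := phi' - q * (D * beta).
Let eV : A := m * phi + q' * (phi' - P * beta).
Let eU : A := m' * aU.

Lemma m_hat_rowV : m * aV + q' * aU = eV.
Proof.
have c1 : GRing.comm m p' by vu.
have c2 : GRing.comm m m' by vu.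
have c3 : GRing.comm p p' by vu.
have c4 : GRing.comm p m' by vu.
apply: (@eq_of_sub_eq _ _ _ (q' * (P - p * D) * beta)).
  rewrite /aV /aU /eV /q /q'; ncring.
by rewrite -(np_pD np) subrr; ncring.
Qed.

(** The column [phi (1, 1)] is the solution [a] of [M a = D (1, 1)], where
    [M] is the inverse of [E T].  Here [eV] and [eU] are the entries of
    [m a]; the system splits into this row and the next. *)
Lemma hat_system_V : aV + eV + b * eV + b * ((N + P) * eV + y * eU) = D.
Proof.
have c1 : GRing.comm N q' by apply: commrD; vu.
have c2 : GRing.comm P q' by apply: commrD; vu.
have c3 : GRing.comm D q' by apply: commrD; vu.
have c4 : GRing.comm E q' by apply: commrD; vu.
have c5 : GRing.comm N N' by vu.
have c6 : GRing.comm P N' by vu.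
have c7 : GRing.comm E E' by vu.
have c8 : GRing.comm N m' by vu.
have c9 : GRing.comm D N' by vu.
have c10 : GRing.comm E N' by vu.
pose h : A := D * beta + (1 + b + b * (N + P)) * (phi' - P * beta).
have hE : h = - (b * Y * E * N' * aU).
  have EqD : E * q * D = E * P - N * D.
    by rewrite mulrDr mulrDl -[E * p * D]mulrA -(np_pD np) (np_Em np) mulNr opprK.
  have c11 : GRing.comm P D by rewrite /GRing.comm {1}(np_Dp np) -[D * p * D]mulrA -(np_pD np).
  rewrite -[h]mul1r -Y1 -mulrA.
  suff -> : (1 - b * N * N') * h = - (b * E * N' * aU) by ncring.
  have c12 : GRing.comm q N' by apply/commr_sym; apply: commrD; apply/commr_sym; vu.
  have c13 : GRing.comm m N' by vu.
  apply: (@eq_of_sub_eq _ _ _ (W * ((1 - b * N' * P) * beta + (b * N' + G) * phi')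
     - (W * G - (1 + b + b * (N + P))) * phi'
     - b * N' * (E * q * D - (E * P - N * D)) * beta
     + (D - (1 + P + b * P + b * P * P)) * beta
     - b * N' * (E - (1 + N + b * N + b * N * N)) * (P * beta - phi'))).
    rewrite /h /aU /W; ncring.
  by rewrite beta_eq addNr W_G EqD -(np_D np) -(np_E np) !subrr; ncring.
have yN' : b * (y * m') = q' * b * Y * E * N'.
  have cY z : GRing.comm z (1 - b * N * N') -> GRing.comm z Y.
    move=> cz; rewrite /GRing.comm.
    transitivity (Y * (1 - b * N * N') * z * Y); first by rewrite Y1 mul1r.
    by rewrite -[Y * _ * z]mulrA -cz -[_ * _ * Y]mulrA -[z * _ * Y]mulrA Y2 mulr1.
  have cmN : GRing.comm m' N' by rewrite /GRing.comm {1}(np_Em np') (np_mE np') mulrN mulNr mulrA.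
  have c14 : GRing.comm N m' by vu.
  have c15 : GRing.comm m' Y.
    by apply: cY; apply: commrB; [apply: commr1|]; rewrite /GRing.comm; ncring.
  have cEN : GRing.comm E N by rewrite (np_E np) /GRing.comm; ncring.
  have c16 : GRing.comm (E * N') Y.
    by apply: cY; apply: commrB; [apply: commr1|]; rewrite /GRing.comm; ncring.
  have yY : y = - (E * q' * E') * Y by rewrite -hat_upper_cornerE -[_ * _ * Y]mulrA Y2 mulr1.
  have -> : y * m' = q' * (E * N') * Y.
    rewrite yY -[_ * Y * m']mulrA -c15 [_ * (m' * Y)]mulrA; congr (_ * _).
    transitivity (E * q' * - (E' * m')); first by ncring.
    by rewrite -(np_Em np') c4 mulrA.
  rewrite -[q' * _ * Y]mulrA c16; ncring.
rewrite /eU [y * _]mulrA.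
apply: (@eq_of_sub_eq _ _ _ (np_ETinv b m P N * phi - D + q' * (h + b * Y * E * N' * aU)
  + (b * (y * m') - q' * b * Y * E * N') * aU + q' * (P - p * D) * 0)).
  rewrite /eV /aV /np_ETinv /h; ncring.
by rewrite ETinv_phi hE yN' addNr !subrr; ncring.
Qed.

(** In this row the letters [y] are conjugated through the inverse of [phi'],
    by [np_conj]. *)
Lemma hat_system_U : aU + eU + b * eU + b * (x * eV + (N' + P') * eU) = D' + xQ.
Proof.
pose Phi : A := (1 - p' - b * p' - b * P' * p') * np_ETinv b m' P' N'.
have [Phi1 DPhi PPhi] : [/\ Phi * phi' = 1, D' * Phi = np_ETinv b m' P' N'
    & P' * Phi = Phi * N' + q'] := np_conj cb np'.
have cM v : v \in [:: p; m; P; N; D; E; T] -> GRing.comm v (np_ETinv b m' P' N').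
  move=> v_in; have c1 : GRing.comm v m' by apply: comm_vu; rewrite // !inE eqxx ?orbT.
  have c2 : GRing.comm v P' by apply: comm_vu; rewrite // !inE eqxx ?orbT.
  have c3 : GRing.comm v N' by apply: comm_vu; rewrite // !inE eqxx ?orbT.
  by rewrite /np_ETinv /GRing.comm; ncring.
have cPhi v : v \in [:: p; m; P; N; D; E; T] -> GRing.comm v Phi.
  move=> v_in; apply: commrM; last exact: cM.
  have c1 : GRing.comm v p' by apply: comm_vu; rewrite // !inE eqxx ?orbT.
  have c2 : GRing.comm v P' by apply: comm_vu; rewrite // !inE eqxx ?orbT.
  by rewrite /GRing.comm; ncring.
have c1 : GRing.comm P Phi by apply: cPhi; rewrite !inE eqxx ?orbT.
have c2 : GRing.comm P N' by vu.
have c3 : GRing.comm P P' by vu.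
have c4 : GRing.comm P q' by apply: commrD; vu.
have c5 : GRing.comm G Phi.
  have c5 : GRing.comm N Phi by apply: cPhi; rewrite !inE eqxx ?orbT.
  have c6 : GRing.comm T Phi by apply: cPhi; rewrite !inE eqxx ?orbT.
  have c7 : GRing.comm D Phi by apply: cPhi; rewrite !inE eqxx ?orbT.
  by rewrite /G /GRing.comm; ncring.
(* Multiplied by [x] on the left, this is the row to be proved. *)
have key : (1 - b * P * P') * Phi * beta = b * eV - (1 + b + b * P + b * P').
  apply: (@eq_of_sub_eq _ _ _ (- (b * P * (P' * Phi - (Phi * N' + q')) * beta)
    + Phi * ((1 - b * N' * P) * beta + (b * N' + G) * phi')
    + b * (P' * Phi - (Phi * N' + q')) * phi'
    - (b * P' + G) * (Phi * phi' - 1)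
    - (G - (1 + b + b * P + b * N * T * D)) - b * (m * phi - - (N * T * D)))).
    rewrite /eV; ncring.
  by rewrite PPhi beta_eq addNr Phi1 m_phiE !subrr; ncring.
have c6 : GRing.comm D (np_ETinv b m' P' N') by apply: cM; rewrite !inE eqxx ?orbT.
have c7 : GRing.comm p (np_ETinv b m' P' N') by apply: cM; rewrite !inE eqxx ?orbT.
have c8 : GRing.comm m (np_ETinv b m' P' N') by apply: cM; rewrite !inE eqxx ?orbT.
have c9 : GRing.comm p D' by vu.
have c10 : GRing.comm m D' by vu.
have c11 : GRing.comm D Phi by apply: cPhi; rewrite !inE eqxx ?orbT.
have c12 : GRing.comm D D' by vu.
have step : x * ((1 - b * P * P') * Phi * beta) = q * D * np_ETinv b m' P' N' * beta.
  transitivity (x * (1 - b * P' * P) * Phi * beta); first by ncring.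
  by rewrite hat_lower_cornerE -DPhi /q; ncring.
rewrite key in step.
have MaU : aU + eU + b * eU + b * (N' + P') * eU = D' - q * D * np_ETinv b m' P' N' * beta.
  rewrite -ETinv_phi'; transitivity (np_ETinv b m' P' N' * aU); first by rewrite /eU /np_ETinv; ncring.
  by rewrite /aU /q; ncring.
transitivity (aU + eU + b * eU + b * (N' + P') * eU + b * x * eV); first by ncring.
by rewrite MaU -step /xQ; ncring.
Qed.

(** The corrections cancel in [q a_V + q' a_U], which is then
    [q phi + q' phi']: this is the primitivity of [q phi]. *)
Lemma phi_hat_ones : exists B, Eh * Th * Dh *m col2 1 1 =
  col2 (phi + q' * B) (phi' - q * B).
Proof.
exists (D * beta); rewrite -/aV -/aU.
have cbh := @scalar_mx_central A 1 b cb.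
have eqM : np_ETinv b%:M (mx2 m q' 0 m') (mx2 P 0 x P') (mx2 N y 0 N') *m col2 aV aU
    = Dh *m col2 1 1.
  rewrite hat_D_entries /np_ETinv !mx2E !mx2_col; congr col2.
  - rewrite mulr1 mul0r addr0 -[RHS]hat_system_V -m_hat_rowV /eU; ncring.
  - rewrite !mulr1 [RHS]addrC -[RHS]hat_system_U -m_hat_rowV /eU; ncring.
by rewrite -mulmxE -mulmxA -eqM mulmxA mulmxE (np_ET_ETinv cbh nph) mul1mx.
Qed.
End Primitive.

(** * Evaluation of series at nilpotent elements *)

Lemma series_mul_cons A A' a w :
  series_mul A A' (a :: w) =
  A [::] * A' (a :: w) + series_mul (fun w => A (a :: w)) A' w.
Proof.
by rewrite /series_mul /= big_ord_recl.
Qed.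

Lemma series_mul_rcons A A' a w :
  series_mul A A' (rcons w a) =
  A (rcons w a) * A' [::] + series_mul A (fun w => A' (rcons w a)) w.
Proof.
rewrite /series_mul size_rcons big_ord_recr /= addrC.
rewrite take_oversize ?drop_oversize ?size_rcons //; congr (_ + _).
apply: eq_bigr => i _; have le_i : (i <= size w)%N by rewrite -ltnS.
by rewrite -cats1 takel_cat // drop_cat; case: ltngtP le_i => // [lt_iw|->] _; rewrite ?cats1 // subnn drop0 drop_size.
Qed.

Lemma geom_inv (B : nzRingType) (z : B) n : z ^+ n = 0 ->
  (\sum_(k < n) z ^+ k) * (1 - z) = 1 /\ (1 - z) * (\sum_(k < n) z ^+ k) = 1.
Proof.
move=> zn0; have e : (1 - z) * (\sum_(k < n) z ^+ k) = 1.
  by rewrite -[LHS]opprK -mulNr opprB -subrX1 zn0 sub0r opprK.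
split=> //; rewrite -[RHS]e mulr_suml mulr_sumr; apply: eq_bigr => k _.
by rewrite mulrBl mulrBr mul1r mulr1 -exprS -exprSr.
Qed.

Section Eval.
Variables (B : nzRingType) (iota : {rmorphism {poly int} -> B}) (p m : B).
Hypothesis ciota : forall r z, GRing.comm (iota r) z.

Definition letter_val (a : letter) : B := if a then m else p.

(** The sum over all words of length less than [N], organized by first
    letter. *)
Fixpoint series_eval N A : B :=
  if N is N'.+1 then
    iota (A [::]) + (p * series_eval N' (fun w => A (lp :: w))
                     + m * series_eval N' (fun w => A (lm :: w)))
  else 0.

Definition word_val w : B := \prod_(a <- w) letter_val a.

(** Only long words vanish, so an induction on the length has to remember the
    letters already read: [z] is their product. *)
Definition kills (z : B) k := forall w, size w = k -> z * word_val w = 0.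

Lemma kills_cons z k a : kills z k.+1 -> kills (z * letter_val a) k.
Proof.
by move=> zk w sz_w; rewrite -mulrA -[RHS](zk (a :: w)) /= ?sz_w // /word_val big_cons.
Qed.

Lemma kills0 z : kills z 0 -> z = 0.
Proof. by move/(_ [::] erefl); rewrite /word_val big_nil mulr1. Qed.

Lemma eq_series_eval N A A' : (forall w, (size w < N)%N -> A w = A' w) ->
  series_eval N A = series_eval N A'.
Proof.
elim: N A A' => [//|N IHN] A A' eqA /=.
by rewrite eqA //; congr (_ + (_ * _ + _ * _)); apply: IHN => w lt_w; apply: eqA.
Qed.

Lemma series_evalD N A A' : series_eval N (fun w => A w + A' w) = series_eval N A + series_eval N A'.
Proof.
elim: N A A' => [|N IHN] A A' /=; first by rewrite addr0.
by rewrite rmorphD !IHN; ncring.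
Qed.

Lemma series_evalZ N c A : series_eval N (fun w => c * A w) = iota c * series_eval N A.
Proof.
elim: N A => [|N IHN] A /=; first by rewrite mulr0.
by rewrite rmorphM !IHN; have := ciota c; move=> cc; ncring.
Qed.

Lemma series_evalN N A : series_eval N (fun w => - A w) = - series_eval N A.
Proof.
elim: N A => [|N IHN] A /=; first by rewrite oppr0.
by rewrite rmorphN !IHN !opprD !mulrN.
Qed.

Lemma series_eval0 N A : (forall w, (size w < N)%N -> A w = 0) -> series_eval N A = 0.
Proof.
elim: N A => [//|N IHN] A A0 /=.
by rewrite A0 // rmorph0 !IHN ?mulr0 ?addr0 // => w lt_w; apply: A0.
Qed.

Lemma series_eval_sum N (I : Type) (r : seq I) (F : I -> series) :
  series_eval N (fun w => \sum_(i <- r) F i w) = \sum_(i <- r) series_eval N (F i).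
Proof.
elim: r => [|i r IHr].
  by rewrite big_nil; apply: series_eval0 => w _; rewrite big_nil.
rewrite big_cons -IHr -series_evalD; apply: eq_series_eval => w _.
by rewrite big_cons.
Qed.

Lemma series_eval_one N : (0 < N)%N -> series_eval N series_one = 1.
Proof.
case: N => // N _ /=; rewrite /series_one eqxx rmorph1.
by rewrite !series_eval0 ?mulr0 ?addr0.
Qed.

Lemma series_eval_stable z k K A : kills z k -> (k <= K)%N -> z * series_eval k A = z * series_eval K A.
Proof.
elim: k K z A => [|k IHk] K z A zk; first by rewrite (kills0 zk) !mul0r.
case: K => // K le_kK /=; rewrite !mulrDr !mulrA.
by rewrite (IHk K _ _ (kills_cons lp zk)) // (IHk K _ _ (kills_cons lm zk)).
Qed.

(** Letters of the first factor are moved into [z]; the second factor is not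
    truncated further, as [series_eval_stable] allows. *)
Lemma series_eval_mul_kills z k K A A' : kills z k -> (k <= K)%N ->
  z * series_eval k (series_mul A A') = z * series_eval k A * series_eval K A'.
Proof.
elim: k z A => [|k IHk] z A zk le_kK; first by rewrite (kills0 zk) !mul0r.
have -> : z * series_eval k.+1 (series_mul A A') =
    iota (A [::]) * (z * series_eval k.+1 A') +
    (z * p * series_eval k (series_mul (fun w => A (lp :: w)) A') +
     z * m * series_eval k (series_mul (fun w => A (lm :: w)) A')).
  rewrite /=.
  have e a : series_eval k (fun w => series_mul A A' (a :: w)) =
     iota (A [::]) * series_eval k (fun w => A' (a :: w)) + series_eval k (series_mul (fun w => A (a :: w)) A').
    by rewrite -series_evalZ -series_evalD; apply: eq_series_eval => w _; rewrite series_mul_cons.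
  rewrite !e /series_mul big_ord1 /= rmorphM.
  have := ciota (A [::]); move=> cc; ncring.
rewrite (series_eval_stable _ zk le_kK).
rewrite (IHk _ _ (kills_cons lp zk) (ltnW le_kK)).
rewrite (IHk _ _ (kills_cons lm zk) (ltnW le_kK)) /=.
have := ciota (A [::]); move=> cc; ncring.
Qed.

Variable N : nat.
Hypothesis nilN : forall w, size w = N -> word_val w = 0.

Lemma series_eval_mul A A' : series_eval N (series_mul A A') = series_eval N A * series_eval N A'.
Proof.
have k1 : kills 1 N by move=> w /nilN ->; rewrite mulr0.
by have := series_eval_mul_kills A A' k1 (leqnn N); rewrite !mul1r.
Qed.

Lemma series_eval_exp A k : (0 < N)%N -> series_eval N (series_exp A k) = series_eval N A ^+ k.
Proof.
move=> N_gt0; elim: k => [|k IHk]; first by rewrite expr0 series_eval_one.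
by rewrite exprS -IHk -series_eval_mul.
Qed.

Lemma nil_letter a : letter_val a ^+ N = 0.
Proof.
by rewrite -(nilN (size_nseq N a)) /word_val big_nseq iter_mulr_1.
Qed.

Definition letter_series (a : letter) (c : nat -> {poly int}) : series :=
  fun w => if w == nseq (size w) a then c (size w) else 0.

Lemma series_eval_letter a c k :
  series_eval k (letter_series a c) = \sum_(i < k) iota (c i) * letter_val a ^+ i.
Proof.
elim: k c => [|k IHk] c; first by rewrite big_ord0.
have eqa : series_eval k (fun w => letter_series a c (a :: w)) = \sum_(i < k) iota (c i.+1) * letter_val a ^+ i.
  rewrite -(IHk (fun i => c i.+1)); apply: eq_series_eval => w _.
  by rewrite /letter_series /= eqseq_cons eqxx.
have neqa e : e != a -> series_eval k (fun w => letter_series a c (e :: w)) = 0.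
  move=> ne; apply: series_eval0 => w _.
  by rewrite /letter_series /= eqseq_cons (negPf ne).
rewrite big_ord_recl expr0 mulr1 /=; congr (_ + _).
transitivity (letter_val a * series_eval k (fun w => letter_series a c (a :: w))).
  clear IHk eqa; case: a neqa => neqa /=.
    by rewrite [series_eval k _](neqa lp) // mulr0 add0r.
  by rewrite [X in _ + _ * X](neqa lm) // mulr0 addr0.
rewrite eqa mulr_sumr; apply: eq_bigr => i _.
by rewrite exprS !mulrA ciota.
Qed.

Lemma val_comm a : commr_rmorph iota (letter_val a).
Proof. by move=> r; apply/commr_sym/ciota. Qed.

Lemma opp_comm : commr_rmorph iota (- m).
Proof. by move=> r; apply/commr_sym/ciota. Qed.

Lemma horner_trunc x (cx : commr_rmorph iota x) (q : {poly {poly int}}) :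
  x ^+ N = 0 -> horner_morph cx q = \sum_(i < N) iota q`_i * x ^+ i.
Proof.
move=> xN0; rewrite -{1}[q](poly_take_drop N) rmorphD rmorphM rmorphXn /=.
rewrite horner_morphX xN0 mulr0 addr0 /take_poly poly_def rmorph_sum /=.
apply: eq_bigr => i _.
by rewrite -mul_polyC rmorphM rmorphXn /= horner_morphX horner_morphC.
Qed.

Hypothesis N_gt0 : (0 < N)%N.

Local Notation C := (narayana_approx N.+1).
Local Notation hp := (horner_morph (val_comm lp)).
Local Notation hm := (horner_morph opp_comm).
Local Notation b := (iota 'X).
Local Notation F := ((1 + C) * (1 + 'X%:P * C)).
Local Notation P := (series_eval N serP).
Local Notation M := (series_eval N serN).
Local Notation D := (series_eval N (fun w => serP (rcons w lp))).
Local Notation E := (- series_eval N (fun w => serN (lm :: w))).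
Local Notation T := (series_eval N serT).

Let pN0 : p ^+ N = 0. Proof. exact: (nil_letter lp). Qed.
Let mN0 : (- m) ^+ N = 0.
Proof. by rewrite exprNn [m ^+ N](nil_letter lm) mulr0. Qed.

Lemma nseq_rcons (k : nat) (a : letter) : rcons (nseq k a) a = nseq k.+1 a.
Proof. by elim: k => //= k ->. Qed.

Lemma series_eval_serP : P = hp C.
Proof.
rewrite horner_trunc // -(series_eval_letter lp (fun i => C`_i)).
apply: eq_series_eval => w lt_w; rewrite /serP /letter_series (narayana_approx_coef (leqW lt_w)).
by case: (size w) => [|k] /=; case: (w == _).
Qed.

Lemma series_eval_serN : M = hm C.
Proof.
rewrite horner_trunc //.
transitivity (\sum_(i < N) iota ((-1) ^+ i * C`_i) * m ^+ i).
  rewrite -(series_eval_letter lm (fun i => (-1) ^+ i * C`_i)).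
  apply: eq_series_eval => w lt_w; rewrite /serN /letter_series (narayana_approx_coef (leqW lt_w)).
  by case: (size w) => [|k] /=; case: (w == _); rewrite ?mulr0.
apply: eq_bigr => i _; rewrite rmorphM rmorph_sign [(- m) ^+ i]exprNn.
by rewrite mulrA ciota.
Qed.

(** The truncation order is one more than the nilpotency order, since [F] is
    read off from ['X * F]. *)
Lemma narayana_factorP : exists r, 'X * F = C + 'X^(N.+1) * r.
Proof. by have [r Cr] := narayana_approxP N.+1; exists r; rewrite mulrA. Qed.

Lemma narayana_factor_coef i : (i < N)%N -> F`_i = ca i.+1.
Proof.
move=> lt_iN; have [r Fr] := narayana_factorP.
have -> : F`_i = ('X * F)`_i.+1 by rewrite coefXM.
by rewrite Fr coefD coef_XnM_lt // addr0 narayana_approx_coef.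
Qed.

Lemma series_eval_serP_rcons : D = hp F.
Proof.
rewrite horner_trunc //.
transitivity (\sum_(i < N) iota (ca i.+1) * p ^+ i); last first.
  by apply: eq_bigr => i _; rewrite narayana_factor_coef.
rewrite -(series_eval_letter lp (fun i => ca i.+1)); apply: eq_series_eval => w _.
rewrite /serP /letter_series size_rcons -nseq_rcons ltn0Sn.
by rewrite eqseq_rcons eqxx andbT.
Qed.

Lemma series_eval_serN_cons : E = hm F.
Proof.
rewrite horner_trunc //.
transitivity (- \sum_(i < N) iota ((-1) ^+ i.+1 * ca i.+1) * m ^+ i).
  rewrite -(series_eval_letter lm (fun i => (-1) ^+ i.+1 * ca i.+1)); congr (- _).
rewrite -sumrN; apply: eq_bigr => i _; rewrite narayana_factor_coef // rmorphM rmorph_sign [(- m) ^+ i]exprNn.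
rewrite exprS mulN1r !mulNr opprK.
by rewrite mulrA ciota.
Qed.

Lemma series_eval_serT : T = \sum_(k < N) (b * P * M) ^+ k.
Proof.
transitivity (series_eval N (fun w => \sum_(k < N) 'X^k * series_exp (series_mul serP serN) k w)).
  apply: eq_series_eval => w lt_w; rewrite /serT.
  rewrite (big_ord_widen _ (fun k => 'X^k * series_exp (series_mul serP serN) k w) lt_w).
  rewrite [RHS](bigID (fun k : 'I_N => (k < (size w).+1)%N)) /= [X in _ = _ + X]big1 ?addr0 // => k.
  by rewrite -leqNgt => lt_wk; rewrite series_exp_PN_eq0 // mulr0.
rewrite series_eval_sum; apply: eq_bigr => k _.
have cb : GRing.comm b (P * M) by apply: ciota.
by rewrite series_evalZ series_eval_exp // series_eval_mul rmorphXn /= -mulrA (exprMn_comm _ cb).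
Qed.

Lemma series_eval_narayana_pair : narayana_pair b p m P M D E T.
Proof.
have hX : hp 'X = p by rewrite horner_morphX.
have hmX : hm 'X = - m by rewrite horner_morphX.
have hb : hp 'X%:P = b by rewrite horner_morphC.
have hmb : hm 'X%:P = b by rewrite horner_morphC.
have [r Fr] := narayana_factorP.
have PM0 : (b * P * M) ^+ N = 0.
  have cb : GRing.comm b (P * M) by apply: ciota.
  rewrite -mulrA (exprMn_comm _ cb).
  rewrite -series_eval_mul -series_eval_exp // series_eval0 ?mulr0 // => w.
  exact: series_exp_PN_eq0.
have hpr : hp ('X^(N.+1) * r) = 0.
  by rewrite rmorphM rmorphXn /= hX exprS pN0 mulr0 mul0r.
have hmr : hm ('X^(N.+1) * r) = 0.
  by rewrite rmorphM rmorphXn /= hmX exprS mN0 mulr0 mul0r.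
have hpX : hp ('X * F) = P by rewrite Fr rmorphD /= hpr addr0 series_eval_serP.
have hmXF : hm ('X * F) = M by rewrite Fr rmorphD /= hmr addr0 series_eval_serN.
have hpC : hp ('X%:P * C) = b * P by rewrite rmorphM /= hb series_eval_serP.
have hmC : hm ('X%:P * C) = b * M by rewrite rmorphM /= hmb series_eval_serN.
have hpb : hp (1 + 'X%:P * C) = 1 + b * P by rewrite rmorphD rmorph1 /= hpC.
have hmb' : hm (1 + 'X%:P * C) = 1 + b * M by rewrite rmorphD rmorph1 /= hmC.
have hp1 : hp (1 + C) = 1 + P by rewrite rmorphD rmorph1 /= series_eval_serP.
have hm1 : hm (1 + C) = 1 + M by rewrite rmorphD rmorph1 /= series_eval_serN.
have cb z : GRing.comm b z by apply: ciota.
split.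
- by rewrite -hpX rmorphM /= hX series_eval_serP_rcons.
- by rewrite -hpX mulrC rmorphM /= hX series_eval_serP_rcons.
- by rewrite series_eval_serP_rcons rmorphM /= hp1 hpb; ncring.
- by rewrite -hmXF rmorphM /= hmX series_eval_serN_cons mulNr.
- by rewrite -hmXF mulrC rmorphM /= hmX series_eval_serN_cons mulrN.
- by rewrite series_eval_serN_cons rmorphM /= hm1 hmb'; ncring.
- by rewrite series_eval_serT; case: (geom_inv PM0).
- by rewrite series_eval_serT; case: (geom_inv PM0).
Qed.

(** The coefficients of [F]: the words of [- N T P] begin with [m] and end with
    [p], and these two letters carry no information on permutations. *)
Definition phi_series : series := fun w => serF (lm :: rcons w lp).

(** Every word of [N] begins with [m] and every word of [P] ends with [p], so
    both letters can be deleted inside the product. *)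
Lemma series_eval_phi : series_eval N phi_series = E * T * D.
Proof.
transitivity (series_eval N (fun w => - series_mul (series_mul (fun w => serN (lm :: w)) serT) (fun w => serP (rcons w lp)) w)).
  apply: eq_series_eval => w _; rewrite /phi_series /serF series_mul_cons; congr (- _).
  have -> : series_mul serN serT [::] = 0.
    by rewrite /series_mul big_ord1 /serN /= mul0r.
  rewrite mul0r add0r series_mul_rcons [serP [::]]/serP /= mulr0 add0r.
  apply: eq_bigr => i _; congr (_ * _).
  by rewrite series_mul_cons [serN [::]]/serN /= mul0r add0r.
by rewrite series_evalN !series_eval_mul !mulNr.
Qed.

End Eval.

(** * Evaluation at the two-state matrices *)

Lemma comm_nil (B : nzRingType) (x y : B) n : GRing.comm x y -> x ^+ n = 0 ->
  (x * y) ^+ n = 0.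
Proof. by move=> cxy xn0; rewrite exprMn_comm // xn0 mul0r. Qed.

Section EvalComm.
Variables (B : nzRingType) (iota : {rmorphism {poly int} -> B}) (p m : B).
Hypothesis ciota : forall r z, GRing.comm (iota r) z.

Lemma series_eval_comm n A z : GRing.comm z p -> GRing.comm z m ->
  GRing.comm z (series_eval iota p m n A).
Proof.
move=> zp zm; elim: n A => [|n IHn] A /=; first exact: commr0.
apply: commrD; first exact/commr_sym/ciota.
by apply: commrD; apply: commrM.
Qed.
End EvalComm.

Section HatPowers.
Variables (A : nzRingType).

Lemma mx2_lower_exp (p q p' : A) i : GRing.comm p p' -> GRing.comm q p' ->
  exists2 x, GRing.comm x p' & mx2 p 0 q p' ^+ i = mx2 (p ^+ i) 0 x (p' ^+ i).
Proof.
move=> cp cq; elim: i => [|i [x cx IHi]].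
  by exists 0; [apply/commr_sym/commr0 | rewrite !expr0 mx2_1].
exists (q * p ^+ i + p' * x).
  apply/commr_sym/commrD; first by apply: commrM; [|apply: commrX]; apply/commr_sym.
  by apply: commrM; [|apply/commr_sym].
by rewrite exprS IHi mx2M !mul0r !mulr0 !addr0 add0r -!exprS.
Qed.

Lemma mx2_upper_exp (m q m' : A) i : GRing.comm m' m -> GRing.comm q m ->
  exists2 y, GRing.comm m y & mx2 m q 0 m' ^+ i = mx2 (m ^+ i) y 0 (m' ^+ i).
Proof.
move=> cm cq; elim: i => [|i [y cy IHi]].
  by exists 0; [apply/commr0 | rewrite !expr0 mx2_1].
exists (m * y + q * m' ^+ i).
  apply/commrD; first by apply: commrM.
  by apply: commrM; [|apply: commrX]; apply/commr_sym.
by rewrite exprS IHi mx2M !mul0r !mulr0 !addr0 add0r -!exprS.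
Qed.
End HatPowers.

Section HatEval.
Variables (A : nzRingType) (iota : {rmorphism {poly int} -> A}).
Hypothesis ciota : forall r z, GRing.comm (iota r) z.

Definition iota2 : {rmorphism {poly int} -> 'M[A]_2} := [the {rmorphism _ -> _} of @scalar_mx A 2 \o iota].

Lemma ciota2 r z : GRing.comm (iota2 r) z.
Proof. exact: (@scalar_mx_central A 1 _ (ciota r)). Qed.

Variables (p m p' m' : A).
Let q := p + m.
Let q' := p' + m'.
Hypotheses (cpp : GRing.comm p p') (cpm : GRing.comm p m') (cmp : GRing.comm m p') (cmm : GRing.comm m m').
Let ph := mx2 p 0 q p'.
Let mh := mx2 m q' 0 m'.

Definition coefP (i : nat) : {poly int} := if i is 0 then 0 else ca i.
Definition coefN (i : nat) : {poly int} := (-1) ^+ i * coefP i.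

Lemma serP_letter : serP =1 letter_series lp coefP.
Proof. by move=> w; rewrite /serP /letter_series; case: (size w) => [|k] /=; case: (w == _). Qed.

Lemma serN_letter : serN =1 letter_series lm coefN.
Proof.
by move=> w; rewrite /serN /letter_series /coefN; case: (size w) => [|k] /=; case: (w == _); rewrite ?mulr0.
Qed.

(** Nothing has to be known of the corner but a commutation: its value is forced
    by the equation of [C], see [hat_lower_cornerE]. *)
Lemma series_eval_hatP n : exists2 x, GRing.comm x (series_eval iota p' m' n serP) &
  series_eval iota2 ph mh n serP =
  mx2 (series_eval iota p m n serP) 0 x (series_eval iota p' m' n serP).
Proof.
rewrite !(eq_series_eval _ _ _ (fun w _ => serP_letter w)).
rewrite !series_eval_letter; try exact: ciota; try exact: ciota2.
set c := coefP; rewrite /=.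
suff [x cx ->] : exists2 x, GRing.comm x p' & \sum_(i < n) iota2 (c i) * ph ^+ i =
    mx2 (\sum_(i < n) iota (c i) * p ^+ i) 0 x (\sum_(i < n) iota (c i) * p' ^+ i).
  exists x => //; apply: commr_sum => i _.
  by apply: commrM; [apply/commr_sym/ciota | apply: commrX].
elim: n => [|n [x cx IHn]].
  by exists 0; [apply/commr_sym/commr0 | rewrite !big_ord0; apply: eq_mx2; rewrite !mxE].
have cq : GRing.comm q p' by apply/commr_sym/commrD; apply/commr_sym.
have [y cy ey] := mx2_lower_exp n cpp cq.
exists (x + iota (c n) * y).
  by apply/commr_sym/commrD; [|apply: commrM; [apply/commr_sym/ciota|]]; apply/commr_sym.
by rewrite !big_ord_recr /= IHn ey mx2_scal mx2M mx2D !mul0r !mulr0 !addr0 !add0r.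
Qed.

Lemma series_eval_hatN n : exists2 y, GRing.comm (series_eval iota p m n serN) y &
  series_eval iota2 ph mh n serN =
  mx2 (series_eval iota p m n serN) y 0 (series_eval iota p' m' n serN).
Proof.
rewrite !(eq_series_eval _ _ _ (fun w _ => serN_letter w)).
rewrite !series_eval_letter; try exact: ciota; try exact: ciota2.
set c := coefN; rewrite /=.
suff [y cy ->] : exists2 y, GRing.comm m y & \sum_(i < n) iota2 (c i) * mh ^+ i =
    mx2 (\sum_(i < n) iota (c i) * m ^+ i) y 0 (\sum_(i < n) iota (c i) * m' ^+ i).
  exists y => //; apply/commr_sym/commr_sum => i _.
  by apply: commrM; [apply/commr_sym/ciota | apply: commrX; apply/commr_sym].
elim: n => [|n [y cy IHn]].
  by exists 0; [apply/commr0 | rewrite !big_ord0; apply: eq_mx2; rewrite !mxE].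
have cq : GRing.comm q' m by apply/commr_sym/commrD.
have [z cz ez] := mx2_upper_exp n (commr_sym cmm) cq.
exists (y + iota (c n) * z).
  by apply: commrD => //; apply: commrM => //; apply/commr_sym/ciota.
by rewrite !big_ord_recr /= IHn ez mx2_scal mx2M mx2D !mul0r !mulr0 !addr0 !add0r.
Qed.

Lemma series_eval_phi_hat n : (0 < n)%N ->
  (forall w, size w = n -> word_val p m w = 0) ->
  (forall w, size w = n -> word_val p' m' w = 0) ->
  (forall w, size w = n -> word_val ph mh w = 0) ->
  exists B, series_eval iota2 ph mh n phi_series *m col2 1 1 =
    col2 (series_eval iota p m n phi_series + q' * B)
         (series_eval iota p' m' n phi_series - q * B).
Proof.
move=> n_gt0 nil_v nil_u nil_h.
have npv := series_eval_narayana_pair ciota nil_v n_gt0.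
have npu := series_eval_narayana_pair ciota nil_u n_gt0.
have nph := series_eval_narayana_pair ciota2 nil_h n_gt0.
have [x cx ePh] := series_eval_hatP n; have [y cy eNh] := series_eval_hatN n.
rewrite ePh eNh in nph.
rewrite (series_eval_phi ciota nil_v) // (series_eval_phi ciota nil_u) // (series_eval_phi ciota2 nil_h) //.
set P := series_eval iota p m n serP in npv cx nph *.
set P' := series_eval iota p' m' n serP in npu cx nph *.
set N := series_eval iota p m n serN in npv cy nph *.
set N' := series_eval iota p' m' n serN in npu nph *.
set D := series_eval iota p m n _ in npv *.
set D' := series_eval iota p' m' n _ in npu *.
set Dh := series_eval iota2 ph mh n _ in nph *.
set E0 := series_eval iota p m n _ in npv *.
set E0' := series_eval iota p' m' n _ in npu *.
set Eh0 := series_eval iota2 ph mh n _ in nph *.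
set T := series_eval iota p m n _ in npv *.
set T' := series_eval iota p' m' n _ in npu *.
set Th := series_eval iota2 ph mh n _ in nph *.
have comm_vu : {in [:: p; m; P; N; D; - E0; T] & [:: p'; m'; P'; N'; D'; - E0'; T'],
  forall v u, GRing.comm v u}.
  have cev S v : GRing.comm v p' -> GRing.comm v m' -> GRing.comm v (series_eval iota p' m' n S).
    exact: series_eval_comm.
  have cv S u : GRing.comm u p -> GRing.comm u m -> GRing.comm u (series_eval iota p m n S).
    exact: series_eval_comm.
  have c1 v : v \in [:: p; m; P; N; D; - E0; T] -> GRing.comm v p' /\ GRing.comm v m'.
    by rewrite !inE => /or4P[/eqP->|/eqP->|/eqP->|/or4P[/eqP->|/eqP->|/eqP->|/eqP->]]; split=> //;
      apply/commr_sym; try apply: commrN; apply: cv; apply/commr_sym.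
  move=> v u /c1[vp vm]; rewrite !inE => /or4P[/eqP->|/eqP->|/eqP->|/or4P[/eqP->|/eqP->|/eqP->|/eqP->]] //;
      try apply: commrN; exact: cev.
have cb z : GRing.comm (iota 'X) z by apply: ciota.
have nilP : P ^+ n = 0.
  rewrite (np_pD npv); apply: comm_nil; last exact: (nil_letter nil_v lp).
  by rewrite /GRing.comm -(np_pD npv) -(np_Dp npv).
have nilN : N ^+ n = 0.
  have cNm : GRing.comm m (- - E0).
    apply: commrN; apply/oppr_inj; rewrite -[LHS](np_mE npv); exact: (np_Em npv).
  by rewrite (np_mE npv) -mulrN; apply: comm_nil cNm (nil_letter nil_v lm).
have cNN' : GRing.comm N N' by apply: comm_vu; rewrite !inE eqxx ?orbT.
have cPN' : GRing.comm P N' by apply: comm_vu; rewrite !inE eqxx ?orbT.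
have zY : (iota 'X * N * N') ^+ n = 0.
  rewrite cb -mulrA; apply: comm_nil => //.
  by apply: commrM; [apply/commr_sym/cb|].
have zZ : (iota 'X * N' * P) ^+ n = 0.
  rewrite -mulrA -cPN' mulrA cb -mulrA; apply: comm_nil => //.
  by apply: commrM; [apply/commr_sym/cb|].
have [Y1 Y2] := geom_inv zY; have [_ Z1] := geom_inv zZ.
exact: (phi_hat_ones cb npv npu comm_vu nph cx cy Y1 Y2 Z1).
Qed.
Definition hat_col n S : 'cV[A]_2 := series_eval iota2 ph mh n S *m col2 1 1.

Lemma hat_colS n S :
  let X e := hat_col n (fun w => S (e :: w)) in
  hat_col n.+1 S = col2
  (iota (S [::]) + (p * X lp 0 0 + (m * X lm 0 0 + q' * X lm 1 0)))
  (iota (S [::]) + (q * X lp 0 0 + p' * X lp 1 0 + m' * X lm 1 0)).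
Proof.
have colE (v : 'cV[A]_2) : v = col2 (v 0 0) (v 1 0).
  apply/colP => i; rewrite mxE; case: i => -[|[|//]] lt_i /=;
  by congr (v _ _); apply: val_inj.
move=> X; have -> : hat_col n.+1 S = mx2 (iota (S [::])) 0 0 (iota (S [::])) *m col2 1 1 +
    (ph *m X lp + mh *m X lm).
  by rewrite /hat_col /= !mulmxDl -!mulmxE -!mulmxA -mx2_scal.
have col2D a b c d : col2 a b + col2 c d = col2 (a + c) (b + d) :> 'cV[A]_2.
  by apply/colP => i; rewrite !mxE; case: (i == 0).
rewrite [X lp]colE [X lm]colE !mx2_col !col2D ![col2 _ _ _ _]mxE /=.
by congr col2; ncring.
Qed.

End HatEval.

(** * Shuffles of two words *)

Definition gaps (c : nat) (w : seq nat) : seq letter := pairmap (fun a b => (b < a)%N) c w.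
Definition descents (w : seq nat) : seq letter := if w is c :: w' then gaps c w' else [::].

Fixpoint shuffle (T : Type) (y : seq T) : seq T -> seq (seq T) :=
  fix shuffle_y z :=
    match y, z with
    | [::], _ => [:: z]
    | _, [::] => [:: y]
    | a :: y', b :: z' => map (cons a) (shuffle y' z) ++ map (cons b) (shuffle_y z')
    end.

Lemma sum_shuffle (T : Type) (V : zmodType) (y z : seq T) (G : seq T -> V) :
  \sum_(w <- shuffle y z) G w =
  (if y is [::] then if z is [::] then G [::] else 0 else 0)
  + ((if y is a :: y' then \sum_(w <- shuffle y' z) G (a :: w) else 0)
  + (if z is b :: z' then \sum_(w <- shuffle y z') G (b :: w) else 0)).
Proof.
have sh0 (s : seq T) F : \sum_(w <- shuffle [::] s) F w = F s :> V by case: s => [|? ?]; rewrite big_seq1.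
have sh0' (s : seq T) F : \sum_(w <- shuffle s [::]) F w = F s :> V by case: s => [|? ?]; rewrite big_seq1.
case: y z => [|a y] [|b z]; rewrite ?sh0 ?sh0' ?addr0 ?add0r //.
by rewrite /= big_cat !big_map.
Qed.

Lemma shuffle_s0 (T : Type) (y : seq T) : shuffle y [::] = [:: y]. Proof. by case: y. Qed.

(** The ring of letters is used only through a linear form [ent]: the entry
    [ent X i j] is the coefficient in [X] of the pair of words left in [gv] and
    [gu] after [i] and [j] letters.  Keeping the ring abstract avoids computing
    with nested matrices. *)
Section ShuffleRead.
Variables (A : nzRingType) (iota : {rmorphism {poly int} -> A}).
Hypothesis ciota : forall r z, GRing.comm (iota r) z.
Variables (v u : letter -> A).
Hypothesis vu_comm : forall e e', GRing.comm (v e) (u e').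
Variables (gv gu : seq letter).
Let l := size gv.
Let k := size gu.
Let N := (l + k).+1.
Let qv := v lp + v lm.
Let qu := u lp + u lm.
Variable ent : A -> nat -> nat -> {poly int}.
Hypothesis entD : forall X Y i j, ent (X + Y) i j = ent X i j + ent Y i j.
Hypothesis ent_v : forall e X i j, (i <= l)%N -> ent (v e * X) i j =
  if (i < l)%N && (nth lp gv i == e) then ent X i.+1 j else 0.
Hypothesis ent_u : forall e X i j, (j <= k)%N -> ent (u e * X) i j =
  if (j < k)%N && (nth lp gu j == e) then ent X i j.+1 else 0.
Hypothesis ent_iota : forall r i j, (i <= l)%N -> (j <= k)%N ->
  ent (iota r) i j = if (i == l) && (j == k) then r else 0.
Hypothesis nil_v : forall w, size w = N -> word_val (v lp) (v lm) w = 0.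
Hypothesis nil_u : forall w, size w = N -> word_val (u lp) (u lm) w = 0.
Hypothesis nil_h : forall w, size w = N ->
  word_val (mx2 (v lp) 0 qv (u lp)) (mx2 (v lm) qu 0 (u lm)) w = 0.

Lemma ent0 i j : ent 0 i j = 0.
Proof. by apply: (addrI (ent 0 i j)); rewrite -entD !addr0. Qed.

Lemma ent_qv X i j : (i <= l)%N ->
  ent (qv * X) i j = if (i < l)%N then ent X i.+1 j else 0.
Proof.
move=> le_i; rewrite /qv mulrDl entD !ent_v //.
by case: ltnP => // _; case: (nth _ _ _); rewrite ?addr0 ?add0r.
Qed.

Lemma ent_qu X i j : (j <= k)%N ->
  ent (qu * X) i j = if (j < k)%N then ent X i j.+1 else 0.
Proof.
move=> le_j; rewrite /qu mulrDl entD !ent_u //.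
by case: ltnP => // _; case: (nth _ _ _); rewrite ?addr0 ?add0r.
Qed.

Definition hatV n (f : series) : A :=
  hat_col iota (v lp) (v lm) (u lp) (u lm) n f 0 0.
Definition hatU n (f : series) : A :=
  hat_col iota (v lp) (v lm) (u lp) (u lm) n f 1 0.

(** After [i] letters of one word and [j] of the other, the evaluation sums over
    the shuffles of what is left; [c] is the last letter read, in the larger word
    for the first equality and in the smaller one for the second.  The word that
    was not read last has a pending gap, whose kind is irrelevant: this is why
    only [behead] of its gap word is constrained. *)
Lemma shuffle_sumP n f i j c (y z : seq nat) : (i <= l)%N -> (j <= k)%N ->
  size z = (l - i)%N -> size y = (k - j)%N -> (size y + size z < n)%N ->
  (forall a b, a \in y -> b \in z -> (a < b)%N) ->
  (drop i gv = gaps c z -> behead (drop j gu) = descents y -> (forall a, a \in y -> (a < c)%N) ->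
    ent (hatV n f) i j = \sum_(w <- shuffle y z) f (gaps c w)) /\
  (drop j gu = gaps c y -> behead (drop i gv) = descents z -> (forall b, b \in z -> (c < b)%N) ->
    ent (hatU n f) i j = \sum_(w <- shuffle y z) f (gaps c w)).
Proof.
elim: n f i j c y z => [//|n IHn] f i j c y z le_i le_j sz_z sz_y lt_n yz.
have lt_i b z' : z = b :: z' -> (i < l)%N by move=> ez; move: sz_z; rewrite ez /=; lia.
have lt_j b y' : y = b :: y' -> (j < k)%N by move=> ey; move: sz_y; rewrite ey /=; lia.
have nth_gv : nth lp gv i = head lp (drop i gv) by rewrite -nth0 nth_drop addn0.
have nth_gu : nth lp gu j = head lp (drop j gu) by rewrite -nth0 nth_drop addn0.
have behead_drop (s : seq letter) d : behead (drop d s) = drop d.+1 s.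
  by rewrite -drop1 drop_drop add1n.
have sz_y' a y' : y = a :: y' -> size y' = (k - j.+1)%N by move=> ey; move: sz_y; rewrite ey /=; lia.
have sz_z' b z' : z = b :: z' -> size z' = (l - i.+1)%N by move=> ez; move: sz_z; rewrite ez /=; lia.
have lt_ny a y' : y = a :: y' -> (size y' + size z < n)%N by move=> ey; move: lt_n; rewrite ey.
have lt_nz b z' : z = b :: z' -> (size y + size z' < n)%N.
  by move=> ez; move: lt_n; rewrite ez /= addnS.
have yz_y a y' : y = a :: y' -> forall a b, a \in y' -> b \in z -> (a < b)%N.
  by move=> ey a' b a'_in; apply: yz; rewrite ey in_cons a'_in orbT.
have yz_z b z' : z = b :: z' -> forall a b, a \in y -> b \in z' -> (a < b)%N.
  by move=> ez a b' a_in b'_in; apply: yz; rewrite // ez in_cons b'_in orbT.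
have hatS B := hat_colS iota (vu_comm lp lp) (vu_comm lp lm)
  (vu_comm lm lp) (vu_comm lm lm) n B.
have hatVE B : hatV n.+1 B = iota (B [::]) + (v lp * hatV n (fun w => B (lp :: w)) +
    (v lm * hatV n (fun w => B (lm :: w)) + qu * hatU n (fun w => B (lm :: w)))).
  by have /colP/(_ 0) := hatS B; rewrite [RHS]mxE.
have hatUE B : hatU n.+1 B = iota (B [::]) + (qv * hatV n (fun w => B (lp :: w)) + u lp * hatU n (fun w => B (lp :: w))
    + u lm * hatU n (fun w => B (lm :: w))).
  by have /colP/(_ 1) := hatS B; rewrite [RHS]mxE.
have nil0 : (if y is [::] then if z is [::] then f (gaps c [::]) else 0 else 0) =
    ent (iota (f [::])) i j.
  rewrite ent_iota //; case: (y) sz_y => [|a y'] /= hy; case: (z) sz_z => [|b z'] /= hz.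
  - by have -> : (i == l) && (j == k) by lia.
  - by have /negPf -> : i != l by lia.
  - have /negPf -> : j != k by lia.
    by rewrite andbF.
  - have /negPf -> : j != k by lia.
    by rewrite andbF.
split=> [dz dy yc|dy dz zc].
  rewrite hatVE sum_shuffle nil0 !entD !ent_v // ent_qu //; congr (_ + _).
  rewrite addrA addrC; congr (_ + _).
    case ey : y => [|a y'].
      by case: ltnP => // lt_jk; move: sz_y; rewrite ey /=; lia.
    rewrite (lt_j _ _ ey).
    have [_ ->] := IHn (fun w => f (lm :: w)) i j.+1 a y' z le_i (lt_j _ _ ey) sz_z (sz_y' _ _ ey) (lt_ny _ _ ey) (yz_y _ _ ey).
    + by apply: eq_bigr => w _; rewrite /= yc // ey mem_head.
    + by rewrite -behead_drop dy ey.
    + by rewrite dz; case: (z).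
    + by move=> b; apply: yz; rewrite ey mem_head.
  case ez : z => [|b z'].
    by case: ltnP => [lt_il|_]; [move: sz_z; rewrite ez /=; lia | rewrite addr0].
  rewrite (lt_i _ _ ez) nth_gv dz ez /=.
  have IH e : (b < c)%N = e -> ent (hatV n (fun w => f (e :: w))) i.+1 j =
      \sum_(w <- shuffle y z') f ((b < c)%N :: gaps b w).
    move=> ->; have [-> //] := IHn (fun w => f (e :: w)) i.+1 j b y z' (lt_i _ _ ez) le_j (sz_z' _ _ ez) sz_y (lt_nz _ _ ez) (yz_z _ _ ez).
    + by rewrite -behead_drop dz ez.
    + by move=> a' a'_in; apply: yz; rewrite // ez mem_head.
  by case: ltnP IH => _ IH /=; rewrite IH // ?addr0 ?add0r.
rewrite hatUE sum_shuffle nil0 !entD !ent_u // ent_qv // -!addrA; congr (_ + _).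
rewrite addrC; congr (_ + _); last first.
  case ez : z => [|b z'].
    by case: ltnP => // lt_il; move: sz_z; rewrite ez /=; lia.
  rewrite (lt_i _ _ ez).
  have [-> ] := IHn (fun w => f (lp :: w)) i.+1 j b y z' (lt_i _ _ ez) le_j (sz_z' _ _ ez) sz_y (lt_nz _ _ ez) (yz_z _ _ ez).
  + by move=> _; apply: eq_bigr => w _; rewrite /= ltnNge ltnW // zc // ez mem_head.
  + by rewrite -behead_drop dz ez.
  + by rewrite dy; case: (y).
  + by move=> a' a'_in; apply: yz; rewrite // ez mem_head.
case ey : y => [|a y'].
  by case: ltnP => [lt_jk|_]; [move: sz_y; rewrite ey /=; lia | rewrite addr0].
rewrite (lt_j _ _ ey) nth_gu dy ey /=.
have IH e : (a < c)%N = e -> ent (hatU n (fun w => f (e :: w))) i j.+1 =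
    \sum_(w <- shuffle y' z) f ((a < c)%N :: gaps a w).
  move=> ->; have [_ -> //] := IHn (fun w => f (e :: w)) i j.+1 a y' z le_i (lt_j _ _ ey) sz_z (sz_y' _ _ ey) (lt_ny _ _ ey) (yz_y _ _ ey).
  + by rewrite -behead_drop dy ey.
  + by move=> b; apply: yz; rewrite ey mem_head.
by case: ltnP IH => _ IH /=; rewrite IH // ?addr0 ?add0r.
Qed.

Lemma ent_eval_v n f i j : (i <= l)%N -> (j < k)%N ->
  ent (series_eval iota (v lp) (v lm) n f) i j = 0.
Proof.
elim: n f i => [|n IHn] f i le_i lt_j; first by rewrite ent0.
rewrite /= !entD ent_iota ?(ltnW lt_j) // (ltn_eqF lt_j) andbF add0r !ent_v //.
by case: ltnP => /= lt_i; rewrite ?addr0 // !IHn // !if_same addr0.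
Qed.

Lemma ent_eval_u n f i j : (i < l)%N -> (j <= k)%N ->
  ent (series_eval iota (u lp) (u lm) n f) i j = 0.
Proof.
elim: n f j => [|n IHn] f j lt_i le_j; first by rewrite ent0.
rewrite /= !entD ent_iota ?(ltnW lt_i) // (ltn_eqF lt_i) /= add0r !ent_u //.
by case: ltnP => /= lt_j; rewrite ?addr0 // !IHn // !if_same addr0.
Qed.

(** By [phi_hat_ones] the two entries are those of the evaluations at one set of
    letters, which vanish on pairs of nonempty words, and corrections that
    cancel. *)
Lemma ent_hat_phi : (0 < l)%N -> (0 < k)%N ->
  ent (hatV N phi_series) 1 0 + ent (hatU N phi_series) 0 1 = 0.
Proof.
move=> l_gt0 k_gt0.
have [B eB] := series_eval_phi_hat ciota (vu_comm lp lp) (vu_comm lp lm)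
  (vu_comm lm lp) (vu_comm lm lm) (ltn0Sn _) nil_v nil_u nil_h.
have -> : hatV N phi_series = series_eval iota (v lp) (v lm) N phi_series + qu * B.
  by rewrite /hatV /hat_col eB mxE.
have -> : hatU N phi_series = series_eval iota (u lp) (u lm) N phi_series - qv * B.
  by rewrite /hatU /hat_col eB mxE.
have := ent_eval_v N phi_series l_gt0 k_gt0.
have := ent_eval_u N phi_series l_gt0 k_gt0.
move: (series_eval _ _ _ N _) (series_eval _ _ _ N _) => X Y Y0 X0.
rewrite -mulrN !entD Y0 X0 ent_qu // ent_qv // l_gt0 k_gt0.
by rewrite !add0r -entD subrr ent0.
Qed.

(** The first letter of a shuffle has no gap before it; the dummy first letters
    of [gv] and [gu] stand for the gaps that the first passage to the other word
    skips. *)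
Lemma shuffle_phi_read a b (y z : seq nat) :
  gv = lp :: gaps b z -> gu = lp :: gaps a y ->
  (forall a' b', a' \in a :: y -> b' \in b :: z -> (a' < b')%N) ->
  \sum_(w <- shuffle (a :: y) (b :: z)) phi_series (descents w) = 0.
Proof.
move=> e_gv e_gu yz.
have sz_gv : l = (size z).+1 by rewrite /l e_gv /= size_pairmap.
have sz_gu : k = (size y).+1 by rewrite /k e_gu /= size_pairmap.
rewrite sum_shuffle add0r -[RHS]ent_hat_phi ?sz_gv ?sz_gu // addrC; congr (_ + _).
  symmetry; apply: (@shuffle_sumP N phi_series 1 0 b (a :: y) z _ _ _ _ _ _).1.
  - by rewrite sz_gv.
  - by [].
  - by rewrite sz_gv subSS subn0.
  - by rewrite sz_gu subn0.
  - by rewrite /N sz_gv sz_gu /=; lia.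
  - by move=> a' b' a'_in b'_in; apply: yz; rewrite // in_cons b'_in orbT.
  - by rewrite e_gv /= drop0.
  - by rewrite e_gu.
  - by move=> a' a'_in; apply: yz; rewrite // mem_head.
symmetry; apply: (@shuffle_sumP N phi_series 0 1 a y (b :: z) _ _ _ _ _ _).2.
- by [].
- by rewrite sz_gu.
- by rewrite sz_gv subn0.
- by rewrite sz_gu subSS subn0.
- by rewrite /N sz_gv sz_gu /=; lia.
- by move=> a' b' a'_in b'_in; apply: yz; rewrite // in_cons a'_in orbT.
- by rewrite e_gu /= drop0.
- by rewrite e_gv.
- by move=> b' b'_in; apply: yz; rewrite // mem_head.
Qed.

End ShuffleRead.

(** * Commuting path matrices *)

Section Step.
Variable S : nzRingType.
Definition step (e : letter) (s : seq letter) : 'M[S]_((size s).+1) :=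
  \matrix_(i, j) ((j == i.+1 :> nat) && (nth lp s i == e))%:R.

Lemma step_mul e s n (X : 'M[S]_((size s).+1, n)) (i : 'I_(size s).+1) j :
  (step e s *m X) i j =
  if (i < size s)%N && (nth lp s i == e) then X (inord i.+1) j else 0.
Proof.
rewrite mxE; case: (ltnP i (size s)) => [lt_i|le_i] /=.
  rewrite (bigD1 (inord i.+1)) //= mxE inordK ?ltnS // eqxx /=.
  rewrite big1 => [|k ne_k]; last first.
    rewrite mxE; case: eqP => [e_k|]; last by rewrite mul0r.
    by case/eqP: ne_k; apply: val_inj; rewrite /= inordK ?ltnS.
  by rewrite addr0; case: eqP; rewrite (mul1r, mul0r).
rewrite big1 // => k _; rewrite mxE; case: eqP => [e_k|]; last by rewrite mul0r.
by have := ltn_ord k; rewrite e_k ltnS ltnNge le_i.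
Qed.
End Step.

Lemma mx2_mul_entry (A : nzRingType) (a b c d : A) (X : 'M[A]_2) i j :
  (mx2 a b c d * X) i j =
  if i == 0 then a * X 0 j + b * X 1 j else c * X 0 j + d * X 1 j.
Proof.
rewrite -mulmxE mxE !big_ord_recl big_ord0 addr0 !mxE /=.
by case: (i == 0); congr (_ * X _ _ + _ * X _ _); apply: val_inj.
Qed.

(** The letters of [gv] act on the rows of the outer matrix and those of [gu] on
    the inner matrices, so that they commute. *)
Section Nested.
Variables (gv gu : seq letter).
Let l := size gv.
Let k := size gu.
Notation R := {poly int}.
Notation Sr := 'M[R]_(k.+1).
Notation Ar := 'M[Sr]_(l.+1).

Definition nest : {rmorphism R -> Ar} :=
  [the {rmorphism _ -> _} of @scalar_mx Sr l.+1 \o @scalar_mx R k.+1].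

Lemma nestE r : nest r = (r%:M)%:M. Proof. by []. Qed.

Lemma nest_central r z : GRing.comm (nest r) z.
Proof.
apply: (@scalar_mx_central Sr l) => u.
exact: (@scalar_mx_central R k r (mulrC r)).
Qed.

Definition vstep e : Ar := step Sr e gv.
Definition ustep e : Ar := (step R e gu)%:M.

Lemma vu_comm e e' : GRing.comm (vstep e) (ustep e').
Proof.
apply/matrixP => i j; rewrite -!mulmxE /ustep -diag_const_mx mul_diag_mx mul_mx_diag !mxE.
exact/commr_sym/commr_nat.
Qed.

Lemma vstepE e (X : Ar) i i' j j' : (vstep e * X) i i' j j' =
  if (i < l)%N && (nth lp gv i == e) then X (inord i.+1) i' j j' else 0.
Proof.
by rewrite -mulmxE /vstep step_mul; case: ifP => // _; rewrite mxE.
Qed.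

Lemma ustepE e (X : Ar) i i' j j' : (ustep e * X) i i' j j' =
  if (j < k)%N && (nth lp gu j == e) then X i i' (inord j.+1) j' else 0.
Proof.
by rewrite -mulmxE /ustep mul_scalar_mx mxE -mulmxE step_mul.
Qed.

Lemma nest_val r i i' j j' :
  nest r i i' j j' = if (i == i') && (j == j') then r else 0.
Proof.
by rewrite nestE !mxE; case: eqP => _; rewrite ?mulr1n ?mulr0n mxE //=; case: eqP.
Qed.

(** Each letter, of either kind, raises the sum of the two indices by one.  This
    also bounds the length of the words in the two-state matrices. *)
Definition graded d (X : Ar) :=
  forall (i i' : 'I_l.+1) (j j' : 'I_k.+1), (i' + j' < i + j + d)%N -> X i i' j j' = 0.

Lemma graded_vstep d e X : graded d X -> graded d.+1 (vstep e * X).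
Proof.
move=> gX i i' j j' lt; rewrite vstepE; case: ifP => // /andP[lt_i _].
by apply: gX; have := @inordK l i.+1 lt_i; lia.
Qed.

Lemma graded_ustep d e X : graded d X -> graded d.+1 (ustep e * X).
Proof.
move=> gX i i' j j' lt; rewrite ustepE; case: ifP => // /andP[lt_j _].
by apply: gX; have := @inordK k j.+1 lt_j; lia.
Qed.

Lemma gradedD d X Y : graded d X -> graded d Y -> graded d (X + Y).
Proof. by move=> gX gY i i' j j' lt; rewrite mxE mxE gX // gY // addr0. Qed.

Lemma graded0 d : graded d 0.
Proof. by move=> i i' j j' _; rewrite mxE mxE. Qed.

Lemma graded1 : graded 0 1.
Proof.
move=> i i' j j' lt; rewrite -(rmorph1 nest) nest_val; case: andP => // -[/eqP ei /eqP ej].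
by move: lt; rewrite ei ej addn0 ltnn.
Qed.

Lemma graded_top X : graded (l + k).+1 X -> X = 0.
Proof.
move=> gX; apply/matrixP => i i'; apply/matrixP => j j'; rewrite (gX i i' j j') ?[0 i i']mxE ?mxE //.
by have := ltn_ord i'; have := ltn_ord j'; lia.
Qed.

Let N := (l + k).+1.

Lemma nil_v w : size w = N -> word_val (vstep lp) (vstep lm) w = 0.
Proof.
move=> sz_w; apply: graded_top; rewrite -/N -sz_w; elim: w {sz_w} => [|e w IHw].
  by rewrite /word_val big_nil; apply: graded1.
by rewrite /word_val big_cons; case: e; apply: graded_vstep.
Qed.

Lemma nil_u w : size w = N -> word_val (ustep lp) (ustep lm) w = 0.
Proof.
move=> sz_w; apply: graded_top; rewrite -/N -sz_w; elim: w {sz_w} => [|e w IHw].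
  by rewrite /word_val big_nil; apply: graded1.
by rewrite /word_val big_cons; case: e; apply: graded_ustep.
Qed.

Definition qv := vstep lp + vstep lm.
Definition qu := ustep lp + ustep lm.
Definition ph := mx2 (vstep lp) 0 qv (ustep lp).
Definition mh := mx2 (vstep lm) qu 0 (ustep lm).

Lemma nil_h w : size w = N -> word_val ph mh w = 0.
Proof.
move=> sz_w; suff g (i j : 'I_2) : graded N (word_val ph mh w i j).
  by apply/matrixP => i j; rewrite (graded_top (g i j)) mxE.
rewrite -sz_w; elim: w {sz_w} i j => [|e w IHw] i j.
  rewrite /word_val big_nil mx2_1 mxE.
  by case: (i == 0); case: (j == 0); (exact: graded1 || exact: graded0).
rewrite /word_val big_cons -/(word_val ph mh w).
have gq d X : graded d X -> graded d.+1 (qv * X) /\ graded d.+1 (qu * X).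
  move=> gX; rewrite /qv /qu !mulrDl.
  by split; apply: gradedD; (exact: graded_vstep || exact: graded_ustep).
have [gV gU] := (IHw 0 j, IHw 1 j).
case: e; rewrite [letter_val _ _ _]/= mx2_mul_entry; case: (i == 0); rewrite ?mul0r ?addr0 ?add0r.
- by apply: gradedD; [apply: graded_vstep | apply: (gq _ _ gU).2].
- exact: graded_ustep.
- exact: graded_vstep.
- by apply: gradedD; [apply: (gq _ _ gV).1 | apply: graded_ustep].
Qed.

Definition ent (X : Ar) (i j : nat) : R := X (inord i) ord_max (inord j) ord_max.

Lemma ent_v e X i j : (i <= l)%N -> ent (vstep e * X) i j =
  if (i < l)%N && (nth lp gv i == e) then ent X i.+1 j else 0.
Proof. by move=> le_i; rewrite /ent vstepE inordK. Qed.

Lemma ent_u e X i j : (j <= k)%N -> ent (ustep e * X) i j =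
  if (j < k)%N && (nth lp gu j == e) then ent X i j.+1 else 0.
Proof. by move=> le_j; rewrite /ent ustepE inordK. Qed.

Lemma entD X Y i j : ent (X + Y) i j = ent X i j + ent Y i j.
Proof. by rewrite /ent !mxE. Qed.

Lemma ent_nest r i j : (i <= l)%N -> (j <= k)%N ->
  ent (nest r) i j = if (i == l) && (j == k) then r else 0.
Proof. by move=> le_i le_j; rewrite /ent nest_val -!val_eqE /= !inordK. Qed.

End Nested.

Lemma shuffle_phi_sep (y z : seq nat) : y != [::] -> z != [::] ->
  (forall a b, a \in y -> b \in z -> (a < b)%N) ->
  \sum_(w <- shuffle y z) phi_series (descents w) = 0.
Proof.
case: y z => [//|a y] [//|b z] _ _ yz.
set gv := lp :: gaps b z; set gu := lp :: gaps a y.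
exact: (@shuffle_phi_read _ _ (@nest_central gv gu) _ _ (@vu_comm gv gu) gv gu
  (@ent gv gu) (@entD gv gu) (@ent_v gv gu) (@ent_u gv gu) (@ent_nest gv gu)
  (@nil_v gv gu) (@nil_u gv gu) (@nil_h gv gu)).
Qed.

(** * Shuffles of words in any relative order *)

Lemma shuffle_map (T U : Type) (f : T -> U) (y z : seq T) :
  shuffle (map f y) (map f z) = map (map f) (shuffle y z).
Proof.
elim: y z => [|a y IHy] z /=; first by case: z.
elim: z => [|b z IHz] //=.
rewrite map_cat -!map_comp; congr (_ ++ _).
  by rewrite -[f b :: _]/(map f (b :: z)) IHy -map_comp.
by rewrite IHz -map_comp.
Qed.

Lemma shuffle_0s (T : Type) (z : seq T) : shuffle [::] z = [:: z]. Proof. by case: z. Qed.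

Lemma shuffle_cons (T : Type) a b (y z : seq T) : shuffle (a :: y) (b :: z) =
  map (cons a) (shuffle y (b :: z)) ++ map (cons b) (shuffle (a :: y) z).
Proof. by []. Qed.

Section ShuffleEq.
Variable T : eqType.
Implicit Types y z w : seq T.

Lemma shuffle_uniq y z : uniq (y ++ z) -> uniq (shuffle y z).
Proof.
elim: y z => [|a y IHy] z; first by case: z.
elim: z => [|b z IHz] //= uyz.
have /andP[a_notin u_y] := uyz.
have ne_ab : a != b by move: a_notin; rewrite mem_cat inE !negb_or => /and3P[].
have u_z : uniq (a :: y ++ z).
  apply: (@subseq_uniq _ _ (a :: y ++ b :: z)) uyz.
  by rewrite /= eqxx cat_subseq // subseq_cons.
rewrite cat_uniq !map_inj_uniq ?IHy ?IHz //; try by move=> ? ? [].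
rewrite andbT /=; apply/hasPn => w /mapP[w' _ ->].
by apply/mapP => -[w'' _ [/eqP]]; rewrite eq_sym (negPf ne_ab).
Qed.

(** Membership in terms of subsequences is what grouping permutations by their
    restrictions needs. *)
Lemma mem_shuffle y z w : uniq (y ++ z) ->
  (w \in shuffle y z) = [&& perm_eq w (y ++ z), subseq y w & subseq z w].
Proof.
have cons_in (a : T) w' (s : seq (seq T)) c :
    (c :: w' \in map (cons a) s) = (c == a) && (w' \in s).
  apply/mapP/andP => [[w'' w''_in [-> ->]] //|[/eqP-> w'_in]]; by [split | exists w'].
elim: w y z => [|c w IHw] y z u_yz.
  case: y z u_yz => [|a y] [|b z] _ //.
  - by rewrite [shuffle _ _]/= mem_seq1 !andbF.
  - by rewrite [shuffle _ _]/= mem_seq1 !andbF.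
  by rewrite [shuffle _ _]/= mem_cat !andbF; apply/orP => -[] /mapP[].
have same (s : seq T) : (c :: w == s) = perm_eq (c :: w) s && subseq s (c :: w).
  apply/eqP/andP => [<-|[p_ws /size_subseq_leqif[_]]]; first by rewrite perm_refl subseq_refl.
  by rewrite (perm_size p_ws) eqxx => /esym/eqP.
case: y u_yz => [|a y] u_yz; first by rewrite shuffle_0s mem_seq1 same sub0seq.
case: z u_yz => [|b z] u_yz.
  by rewrite shuffle_s0 mem_seq1 same cats0 sub0seq andbT.
have /andP[a_notin u_y] := u_yz.
have u_z : uniq (a :: y ++ z).
  by apply: subseq_uniq u_yz; rewrite /= eqxx cat_subseq // subseq_cons.
rewrite shuffle_cons mem_cat !cons_in !IHw //.
have ne_ab : a != b by move: a_notin; rewrite mem_cat inE !negb_or => /and3P[].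
have p_b : perm_eq (b :: w) ((a :: y) ++ b :: z) = perm_eq w ((a :: y) ++ z).
  have /permPr -> : perm_eq ((a :: y) ++ b :: z) (b :: (a :: y) ++ z).
    by apply/permPl; exact: (perm_catCA (a :: y) [:: b] z).
  by rewrite perm_cons.
have [->|ne_ca] := eqVneq c a.
  by rewrite (negPf ne_ab) orbF /= perm_cons eqxx [b == a]eq_sym (negPf ne_ab).
have [->|ne_cb] := eqVneq c b.
  have -> : subseq (a :: y) (b :: w) = subseq (a :: y) w by rewrite /= (negPf ne_ab).
  have -> : subseq (b :: z) (b :: w) = subseq z w by rewrite /= eqxx.
  by rewrite p_b orFb.
rewrite /= [a == c]eq_sym [b == c]eq_sym (negPf ne_ca) (negPf ne_cb); apply/esym/negP.
case/and3P=> p_w sy sz; have /andP[/negP[]] : uniq (c :: w) by rewrite (perm_uniq p_w).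
have : c \in a :: y ++ b :: z by rewrite -(perm_mem p_w) mem_head.
rewrite -cat_cons mem_cat => /orP[] c_in; [exact: (mem_subseq sy) | exact: (mem_subseq sz)].
Qed.
End ShuffleEq.

Definition swap (v v' a : nat) : nat := if a == v then v' else if a == v' then v else a.

Lemma swapK v v' : involutive (swap v v').
Proof.
move=> a; rewrite /swap; case: (eqVneq a v) => [->|nv].
  by rewrite eqxx; case: eqP.
case: (eqVneq a v') => [->|nv']; first by rewrite eqxx.
by rewrite (negPf nv) (negPf nv').
Qed.

Definition touching (v v' : nat) (w : seq nat) := infix [:: v; v'] w || infix [:: v'; v] w.

Lemma descents_swap v v' w :
  (forall a, a \in w -> a = v \/ a = v' \/ ((a < v)%N = (a < v')%N /\ (v < a)%N = (v' < a)%N)) ->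
  uniq w -> ~~ touching v v' w -> descents (map (swap v v') w) = descents w.
Proof.
case: w => [|c w] //=; elim: w c => [|d w IHw] c //= between /andP[c_notin u_w] not_t.
have [bc bd] := (between c (mem_head _ _), between d).
congr (_ :: _); last first.
  apply: IHw => //; first by move=> a a_in; apply: between; rewrite in_cons a_in orbT.
  by apply: contra not_t; rewrite /touching /= => /orP[] ->; rewrite ?orbT.
have {}bd := bd _; move: bd; rewrite !inE eqxx orbT => /(_ isT) bd.
have ne_cd : c != d by move: c_notin; rewrite inE negb_or => /andP[].
move: not_t; rewrite /touching /= !prefix0s !andbT !negb_or.
move=> /andP[/andP[n1 _] /andP[n2 _]].
rewrite /swap; case: (c =P v) => cv; case: (d =P v) => dv; case: (c =P v') => cv';
  case: (d =P v') => dv'; subst; rewrite ?eqxx in n1 n2 ne_cd *; try by [].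
all: try by case: bc => [|[|[]]]; case: bd => [|[|[]]]; lia.
Qed.

Lemma swap_fix v v' (s : seq nat) : v \notin s -> v' \notin s -> map (swap v v') s = s.
Proof.
move=> v_s v'_s; apply: map_id_in => a a_s; rewrite /swap.
case: eqP => [ea|_]; first by rewrite -ea a_s in v_s.
by case: eqP => // ea; rewrite -ea a_s in v'_s.
Qed.

Lemma swap_l v v' : swap v v' v = v'. Proof. by rewrite /swap eqxx. Qed.
Lemma swap_r v v' : swap v v' v' = v. Proof. by rewrite /swap eqxx; case: eqP. Qed.

Lemma touchingP v v' w : uniq w -> touching v v' w ->
  exists p c d r, [/\ w = p ++ [:: c; d] ++ r,
    map (swap v v') w = p ++ [:: d; c] ++ r & (c, d) = (v, v') \/ (c, d) = (v', v)].
Proof.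
have main c d p r : uniq (p ++ [:: c; d] ++ r) -> map (swap c d) (p ++ [:: c; d] ++ r) = p ++ [:: d; c] ++ r.
  rewrite uniq_catCA /= inE !mem_cat !negb_or => /and3P[/and3P[_ c_p c_r] /andP[d_p d_r] _].
  by rewrite !map_cat /= !swap_fix // swap_l swap_r.
have swapC : swap v v' =1 swap v' v.
  by move=> a; rewrite /swap; case: eqP => [->|]; case: eqP.
move=> u_w /orP[] /infixP[p [r ew]]; rewrite ew in u_w *.
  by exists p, v, v', r; split=> //; [exact: main | left].
by exists p, v', v, r; split=> //; [rewrite (eq_map swapC); exact: main | right].
Qed.

Lemma touching_swap v v' w : uniq w -> touching v v' w -> touching v v' (map (swap v v') w).
Proof.
move=> u_w /(touchingP u_w)[p [c [d [r [_ -> [] [-> ->]]]]]]; apply/orP; [right|left];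
  by apply/infixP; exists p, r.
Qed.

Lemma subseq_touch (T : eqType) (s p r : seq T) c d :
  uniq (p ++ [:: c; d] ++ r) -> subseq s (p ++ [:: c; d] ++ r) ->
  ~~ ((c \in s) && (d \in s)) -> subseq s (p ++ [:: d; c] ++ r).
Proof.
move=> u_w /(subseq_uniqP u_w) es not_both; rewrite {1}es.
suff -> : filter (mem s) (p ++ [:: c; d] ++ r) = filter (mem s) (p ++ [:: d; c] ++ r).
  exact: filter_subseq.
rewrite !filter_cat /=; move: not_both.
by case: (c \in s); case: (d \in s).
Qed.

(** Exchanging two values with no letter in between changes the descents of a
    shuffle only if they are adjacent in it, and then it has the same effect as
    exchanging their places, which yields another shuffle of the same words. *)
Lemma sum_shuffle_swap (V : zmodType) (G : seq letter -> V) y z v v' :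
  uniq (y ++ z) -> v \in y -> v' \in z ->
  (forall a, a \in y ++ z ->
     a = v \/ a = v' \/ ((a < v)%N = (a < v')%N /\ (v < a)%N = (v' < a)%N)) ->
  \sum_(w <- shuffle (map (swap v v') y) (map (swap v v') z)) G (descents w) =
  \sum_(w <- shuffle y z) G (descents w).
Proof.
move=> u_yz v_y v'_z between; rewrite shuffle_map big_map.
have shP w : w \in shuffle y z -> [/\ perm_eq w (y ++ z), uniq w, subseq y w & subseq z w].
  by rewrite mem_shuffle // => /and3P[p_w sy sz]; split; rewrite // (perm_uniq p_w).
have v_z : v \notin z by move: u_yz; rewrite cat_uniq => /and3P[_ /hasPn/(_ _)H _]; apply/negP => /H; rewrite /= v_y.
have v'_y : v' \notin y by move: u_yz; rewrite cat_uniq => /and3P[_ /hasPn/(_ _ v'_z) ].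
pose theta w := if touching v v' w then map (swap v v') w else w.
have theta_in w : w \in shuffle y z -> theta w \in shuffle y z.
  move=> w_in; rewrite /theta; case: ifP => // t_w.
  have [p_w u_w sy sz] := shP w w_in.
  have [p [c [d [r [ew -> cd]]]]] := touchingP u_w t_w.
  rewrite ew in p_w u_w sy sz; rewrite mem_shuffle //; apply/and3P; split.
  - by rewrite -(permPr p_w) perm_cat2l perm_cat2r -[[:: d; c]]/(rot 1 [:: c; d]) perm_rot.
  - by apply: subseq_touch => //; case: cd => -[-> ->]; rewrite (negPf v'_y) ?andbF.
  - by apply: subseq_touch => //; case: cd => -[-> ->]; rewrite (negPf v_z) ?andbF.
have thetaK : {in shuffle y z, involutive theta}.
  move=> w w_in; have [_ u_w _ _] := shP w w_in; rewrite {2}/theta; case: ifP => t_w.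
    by rewrite /theta touching_swap // (mapK (@swapK v v')).
  by rewrite /theta t_w.
transitivity (\sum_(w <- map theta (shuffle y z)) G (descents w)); last first.
  apply: perm_big; apply: uniq_perm; rewrite ?shuffle_uniq // ?map_inj_in_uniq ?shuffle_uniq //.
    exact: (can_in_inj thetaK).
  move=> w; apply/mapP/idP => [[w' w'_in ->]|w_in]; first exact: theta_in.
  by exists (theta w); rewrite ?thetaK // theta_in.
rewrite big_map; apply: eq_big_seq => w w_in; congr (G _).
have [p_w u_w _ _] := shP w w_in.
rewrite /theta; case: ifPn => // not_t; apply: descents_swap => //.
by move=> a; rewrite (perm_mem p_w); apply: between.
Qed.

(** Exchanging consecutive values brings the letters of [y] below those of [z];
    the sum of the letters of [y] decreases at each step. *)
Lemma shuffle_phi (y z : seq nat) : uniq (y ++ z) -> y != [::] -> z != [::] ->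
  \sum_(w <- shuffle y z) phi_series (descents w) = 0.
Proof.
have [n] := ubnP (sumn y); elim: n y z => // n IHn y z le_n u_yz y0 z0.
have [/allrelP sep|not_sep] := boolP (allrel ltn y z); first exact: shuffle_phi_sep.
(* An inversion of minimal height has no letter strictly between its values. *)
have [v [v' [v_y v'_z lt_v'v gap]]] : exists v v', [/\ v \in y, v' \in z, (v' < v)%N &
    forall a, a \in y ++ z -> ~~ (v' < a < v)%N].
  have [a [b [a_y b_z lt_ba]]] : exists a b, [/\ a \in y, b \in z & (b < a)%N].
    case/allPn: not_sep => a a_y /allPn[b b_z]; rewrite -leqNgt => le_ba.
    exists a, b; split=> //; rewrite ltn_neqAle le_ba andbT.
    apply: contraTneq u_yz => eba; rewrite cat_uniq -eba in a_y *.
    by apply/negP => /and3P[_ /hasPn/(_ b b_z)]; rewrite /= a_y.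
  have [k] := ubnP (a - b)%N; elim: k a b a_y b_z lt_ba => // k IHk a b a_y b_z lt_ba le_k.
  have [/hasP[c c_in /andP[lt_bc lt_ca]]|no_c] := boolP (has (fun c => b < c < a)%N (y ++ z)).
    move: c_in; rewrite mem_cat => /orP[c_y|c_z].
      by apply: (IHk c b) => //; lia.
    by apply: (IHk a c) => //; lia.
  by exists a, b; split=> // c c_in; have := hasPn no_c c c_in.
rewrite -(@sum_shuffle_swap _ _ _ _ v v') //; last first.
  move=> a a_in; have := gap a a_in.
  case: (a =P v) => [|ne_v]; first by left.
  case: (a =P v') => [|ne_v' not_in]; first by right; left.
  by right; right; lia.
apply: IHn; rewrite -?size_eq0 ?size_map ?size_eq0 //.
  have v'_y : v' \notin y by move: u_yz; rewrite cat_uniq => /and3P[_ /hasPn/(_ _ v'_z) ].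
  have u_y : uniq y by move: u_yz; rewrite cat_uniq => /andP[].
  rewrite -ltnS; apply: leq_trans le_n; rewrite ltnS.
  case/splitPr: v_y u_y v'_y => p r; rewrite -cat1s uniq_catCA cat1s /= mem_cat negb_or.
  move=> /andP[/andP[v_p v_r] _]; rewrite !mem_cat inE !negb_or => /and3P[v'_p _ v'_r].
  by rewrite map_cat /= swap_l !swap_fix // !sumn_cat /= ltn_add2l ltn_add2r.
by rewrite -map_cat map_inj_uniq //; apply: inv_inj; apply: swapK.
Qed.

(** * The alternating sum of the coefficients *)

Fixpoint alternating (n : nat) (f : series) : {poly int} :=
  if n is n'.+1 then
    alternating n' (fun w => f (lp :: w) - f (lm :: w))
  else f [::].

Lemma series_eval_opp (B : nzRingType) (iota : {rmorphism {poly int} -> B}) t n f :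
  (forall r z, GRing.comm (iota r) z) ->
  series_eval iota t (- t) n f = \sum_(k < n) iota (alternating k f) * t ^+ k.
Proof.
move=> ci; elim: n f => [|n IHn] f; first by rewrite big_ord0.
rewrite big_ord_recl expr0 mulr1 /= mulNr -mulrBr; congr (_ + _).
rewrite -series_evalN -series_evalD IHn mulr_sumr; apply: eq_bigr => k _.
by rewrite exprS !mulrA ci.
Qed.

Section Commutative.
Variables (B : nzRingType) (iota : {rmorphism {poly int} -> B}) (t : B) (n : nat).
Hypothesis ciota : forall r z, GRing.comm (iota r) z.
Let N := n.+1.
Hypothesis tN0 : t ^+ N = 0.

Lemma word_val_opp_nil w : size w = N -> word_val t (- t) w = 0.
Proof.
move=> sz_w; suff [e ->] : exists e : bool, word_val t (- t) w = (-1) ^+ e * t ^+ size w.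
  by rewrite sz_w tN0 mulr0.
elim: w {sz_w} => [|a w [e IHw]]; first by exists false; rewrite /word_val big_nil mul1r.
rewrite /word_val big_cons -/(word_val _ _ w) IHw.
case: a => /=; last by exists e; rewrite exprS !mulrA commr_sign.
by exists (~~ e); rewrite signrN exprS !mulNr !mulrA commr_sign.
Qed.

(** Differentiating [C = t F], where [F = (1 + C) (1 + b C)], gives
    [C' (1 - t (1 + b + 2 b C)) = F]; multiplying by [F] removes [t]. *)
Lemma narayana_deriv : exists r,
  ((1 + narayana_approx N.+1) * (1 + 'X%:P * narayana_approx N.+1)) ^+ 2 =
  (1 - 'X%:P * narayana_approx N.+1 ^+ 2) * (narayana_approx N.+1)^`() + 'X^N * r.
Proof.
have [r] := narayana_approxP N.+1; move: (narayana_approx N.+1) => C Cr.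
set F := (1 + C) * (1 + 'X%:P * C).
have dF : F^`() = C^`() * (1 + 'X%:P + 'X%:P * C *+ 2).
    rewrite /F derivM !derivD derivM !derivC; ring.
have XF : 'X * F = C + 'X^(N.+1) * r by rewrite /F mulrA Cr.
have dXF : F + 'X * F^`() = C^`() + 'X^N * (r *+ N.+1 + 'X * r^`()).
  have := congr1 (@deriv _) XF; rewrite derivM derivX mul1r => ->.
  by rewrite derivD derivM derivXn exprS; ring.
exists (F * (r *+ N.+1 + 'X * r^`()) - 'X * r * (C^`() * (1 + 'X%:P + 'X%:P * C *+ 2))).
have -> : F ^+ 2 = F * (F + 'X * F^`()) - ('X * F) * F^`() by ring.
rewrite dXF XF dF exprS /F; ring.
Qed.

(** At [m = - t] both [P] and [N] become [C(t)], so that [phi] becomes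
    [D^2 / (1 - b C^2)]. *)
Lemma series_eval_phi_opp :
  series_eval iota t (- t) N phi_series =
  \sum_(k < N) iota (narayana_approx N.+1)^`()`_k * t ^+ k.
Proof.
have tN := word_val_opp_nil; have ct : commr_rmorph iota t by move=> r; apply/commr_sym/ciota.
have np := series_eval_narayana_pair ciota tN (ltn0Sn n).
rewrite (series_eval_phi ciota tN) // -(horner_trunc ct) //.
have hopp (q : {poly {poly int}}) : horner_morph (opp_comm (- t) ciota) q = horner_morph ct q.
  by rewrite /horner_morph opprK.
have [r dC] := narayana_deriv.
have eP := series_eval_serP ciota tN.
have eM := series_eval_serN ciota tN.
have eD := series_eval_serP_rcons ciota tN.
have eE := series_eval_serN_cons ciota tN.
rewrite -/N in np eP eM eD eE *.
rewrite hopp in eM; rewrite hopp in eE.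
have {}eM : series_eval iota t (- t) N serN = series_eval iota t (- t) N serP by rewrite eM eP.
have {}eE : - series_eval iota t (- t) N (fun w => serN (lm :: w)) =
  series_eval iota t (- t) N (fun w => serP (rcons w lp)) by rewrite eE eD.
rewrite eE eM in np *.
move: np eP eD.
set P := series_eval _ _ _ _ serP; set T := series_eval _ _ _ _ serT; set D := series_eval _ _ _ _ _.
move: P T D => P T D np eP eD.
have hb : horner_morph ct 'X%:P = iota 'X by rewrite horner_morphC.
have hX : horner_morph ct 'X = t by rewrite horner_morphX.
move: dC eD eP; move: (narayana_approx N.+1) => C dC eD eP.
have cb := ciota 'X.
have {}eD : D = horner_morph ct ((1 + C) * (1 + 'X%:P * C)) := eD.
have {}eP : P = horner_morph ct C := eP.
have DD : D * D = (1 - iota 'X * P * P) * horner_morph ct C^`().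
  transitivity (horner_morph ct (C^`() - 'X%:P * C * C * C^`() + 'X^N * r)).
    by rewrite eD -rmorphM /= -expr2 dC; congr (horner_morph ct _); ring.
  rewrite rmorphD rmorphB !rmorphM rmorphXn /= hb hX tN0 mul0r addr0 -eP.
  by rewrite mulrBl mul1r.
have [_ _ eDD _ _ _ T1 T2] := np.
have cDP : D * (1 - iota 'X * P * P) = (1 - iota 'X * P * P) * D by rewrite eDD; ncring.
have DT : D * T = T * D.
  rewrite -[D * T]mul1r -T1 -mulrA [_ * (D * T)]mulrA -cDP.
  by rewrite -[D * _ * T]mulrA T2 mulr1.
by rewrite DT -mulrA DD mulrA T1 mul1r.
Qed.
End Commutative.

(** Coefficients of powers of [t] are extracted with [t] a nilpotent Jordan
    block. *)
Section Jordan.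
Variable n : nat.
Let N := n.+1.
Let s := nseq n lp.
Let t := vstep s [::] lp.
Let io := nest s [::].

Let sn : size s = n. Proof. by rewrite size_nseq. Qed.

Lemma power_nil : t ^+ N = 0.
Proof.
have sz : size (nseq N lp) = (size s + size (@nil letter)).+1 by rewrite size_nseq sn addn0.
have := nil_v sz.
by rewrite /word_val big_nseq iter_mulr_1.
Qed.

Lemma ent_power r k i : (i <= n)%N -> ent (t ^+ k * io r) i 0 = if (i + k == n)%N then r else 0.
Proof.
elim: k i => [|k IHk] i le_i.
  by rewrite mul1r addn0 ent_nest ?sn // eqxx andbT.
rewrite exprS -mulrA ent_v ?sn // addnS -addSn; case: ltnP => [lt_in|le_ni] /=.
  by have lt_in' : (i < n)%N; [rewrite -sn | rewrite nth_nseq lt_in' /= IHk].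
by rewrite sn in le_ni; case: eqP => // e; lia.
Qed.

Lemma ent_powers (c : nat -> {poly int}) k : (k <= N)%N ->
  ent (\sum_(i < k) io (c i) * t ^+ i) 0 0 = if k == N then c n else 0.
Proof.
elim: k => [|k IHk] lt_k; first by rewrite big_ord0 /ent !mxE.
rewrite big_ord_recr /= entD (IHk (ltnW lt_k)) [io _ * _]nest_central ent_power // add0n.
by rewrite eqSS (ltn_eqF lt_k) add0r; case: eqP => // ->.
Qed.

End Jordan.

Lemma alternating_phi n : alternating n phi_series = ca n.+1 *+ n.+1.
Proof.
have e := series_eval_phi_opp (@nest_central (nseq n lp) [::]) (power_nil n).
rewrite series_eval_opp in e; last exact: nest_central.
have := ent_powers (fun k => alternating k phi_series) (leqnn n.+1).
rewrite e eqxx => <-.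
rewrite (ent_powers (fun k => (narayana_approx n.+2)^`()`_k) (leqnn n.+1)) eqxx.
by rewrite coef_deriv narayana_approx_coef.
Qed.

(** * Sums over permutations *)

Lemma index_subseq (T : eqType) (y w : seq T) a b : uniq w -> subseq y w ->
  a \in y -> b \in y -> (index a y < index b y)%N = (index a w < index b w)%N.
Proof.
elim: w y => [|c w IHw] [|d y] //= /andP[c_w u_w].
case: (eqVneq d c) => [->|ne_dc] sub; rewrite !inE.
  rewrite [c == a]eq_sym [c == b]eq_sym.
  have [->|ne_a] := eqVneq a c; have [->|ne_b] := eqVneq b c => //= a_y b_y.
  by rewrite !ltnS; apply: IHw.
have c_dy : c \notin d :: y by apply: contra c_w; apply: mem_subseq.
move=> a_y b_y.
have -> : (c == a) = false by apply: contraNF c_dy => /eqP->; rewrite inE.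
have -> : (c == b) = false by apply: contraNF c_dy => /eqP->; rewrite inE.
by rewrite ltnS; apply: (IHw (d :: y)); rewrite ?inE.
Qed.

(** If [x] and [w] are the one-line notations of [u] and [s^-1 * u], this is the
    one-line notation of [s]. *)
Definition positions (x w : seq nat) : seq nat := [seq index a w | a <- x].

Lemma descents_positions x y w : uniq w -> subseq y w -> {subset x <= y} ->
  descents (positions x w) = descents (positions x y).
Proof.
move=> u_w sub; case: x => [|a x] //=; elim: x a => [|b x IHx] a //= x_y.
rewrite (index_subseq u_w sub) ?x_y ?inE ?eqxx ?orbT //.
by congr (_ :: _); apply: IHx => c c_in; apply: x_y; rewrite inE c_in orbT.
Qed.

Lemma descents_cat a s1 b s2 :
  descents ((a :: s1) ++ b :: s2) =
  descents (a :: s1) ++ (b < last a s1)%N :: descents (b :: s2).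
Proof. by rewrite /= /gaps pairmap_cat. Qed.

Lemma sum_permutations_cat (V : nmodType) (x1 x2 : seq nat) (G : seq nat -> V) :
  uniq (x1 ++ x2) ->
  \sum_(w <- permutations (x1 ++ x2)) G w =
  \sum_(y <- permutations x1) \sum_(z <- permutations x2) \sum_(w <- shuffle y z) G w.
Proof.
move=> u_x; set x := x1 ++ x2.
have in_p1 w : w \in permutations x -> filter (mem x1) w \in permutations x1.
  rewrite !mem_permutations => p_w; rewrite (permPl (perm_filter _ p_w)) filter_cat.
  have -> : filter (mem x1) x1 = x1 by apply/all_filterP/allP.
  suff -> : filter (mem x1) x2 = [::] by rewrite cats0.
  apply/eqP; rewrite -[_ == _]negbK -has_filter.
  by move: u_x; rewrite cat_uniq => /and3P[].
have in_p2 w : w \in permutations x -> filter (mem x2) w \in permutations x2.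
  rewrite !mem_permutations => p_w; rewrite (permPl (perm_filter _ p_w)) filter_cat.
  have -> : filter (mem x2) x2 = x2 by apply/all_filterP/allP.
  suff -> : filter (mem x2) x1 = [::] by [].
  apply/eqP; rewrite -[_ == _]negbK -has_filter.
  by rewrite has_sym; move: u_x; rewrite cat_uniq => /and3P[].
transitivity (\sum_(w <- permutations x) \sum_(y <- permutations x1) \sum_(z <- permutations x2)
    if (y == filter (mem x1) w) && (z == filter (mem x2) w) then G w else 0).
  apply: eq_big_seq => w w_in.
  rewrite (bigD1_seq _ (in_p1 w w_in)) ?permutations_uniq //= [X in _ + X]big1_seq ?addr0 => [|y /andP[/negPf ne_y _]]; last first.
    by rewrite big1 // => z _; rewrite ne_y.
  rewrite (bigD1_seq _ (in_p2 w w_in)) ?permutations_uniq //= !eqxx big1_seq ?addr0 // => z /andP[/negPf ne_z _].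
  by rewrite ne_z.
rewrite exchange_big /=; apply: eq_big_seq => y y_in.
rewrite exchange_big /=; apply: eq_big_seq => z z_in.
rewrite -big_mkcond -big_filter /=; apply: perm_big.
move: y_in z_in; rewrite !mem_permutations => p_y p_z.
have u_yz : uniq (y ++ z) by rewrite (perm_uniq (perm_cat p_y p_z)).
apply: uniq_perm; rewrite ?filter_uniq ?permutations_uniq ?shuffle_uniq //.
move=> w; rewrite mem_filter mem_shuffle // mem_permutations.
rewrite andbC (permPr (perm_cat p_y p_z)); case p_w : (perm_eq w x) => //=.
have u_w : uniq w by rewrite (perm_uniq p_w).
have fy : filter (mem x1) w = filter (mem y) w.
  by apply: eq_filter => a; rewrite /= (perm_mem p_y).
have fz : filter (mem x2) w = filter (mem z) w.
  by apply: eq_filter => a; rewrite /= (perm_mem p_z).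
by rewrite fy fz; congr (_ && _); apply/eqP/(subseq_uniqP u_w).
Qed.

(** The omitted descent of [s] is the one at the end of [x1].  The other ones
    depend only on the restrictions of [w] to the letters of [x1] and of [x2], so
    the coefficient is constant on the shuffles of two words. *)
Lemma sum_ignoring_descent_eq0 (x1 x2 : seq nat) (K1 K2 : seq letter -> {poly int}) :
  uniq (x1 ++ x2) -> x1 != [::] -> x2 != [::] ->
  \sum_(w <- permutations (x1 ++ x2)) K1 (descents (positions x1 w)) *
     K2 (descents (positions x2 w)) * phi_series (descents w) = 0.
Proof.
move=> u_x x1_0 x2_0; rewrite sum_permutations_cat //.
rewrite big1_seq // => y /andP[_]; rewrite mem_permutations => p_y.
rewrite big1_seq // => z /andP[_]; rewrite mem_permutations => p_z.
have u_yz : uniq (y ++ z) by rewrite (perm_uniq (perm_cat p_y p_z)).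
rewrite (eq_big_seq (fun w => K1 (descents (positions x1 y)) * K2 (descents (positions x2 z))
    * phi_series (descents w))); last first.
  move=> w; rewrite mem_shuffle // => /and3P[p_w sy sz].
  have u_w : uniq w by rewrite (perm_uniq p_w).
  rewrite (descents_positions u_w sy) => [|a]; last by rewrite (perm_mem p_y).
  by rewrite (descents_positions u_w sz) => [|a]; last by rewrite (perm_mem p_z).
rewrite -mulr_sumr shuffle_phi ?mulr0 //.
  by rewrite -size_eq0 (perm_size p_y) size_eq0.
by rewrite -size_eq0 (perm_size p_z) size_eq0.
Qed.

Lemma positions_sorted x w : uniq x -> perm_eq w x ->
  all (pred1 lp) (descents (positions x w)) -> w = x.
Proof.
move=> u_x p_w all_lp; have u_w : uniq w by rewrite (perm_uniq p_w).
have sorted_p : sorted leq (positions x w).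
  move: all_lp; case: (positions x w) => [|a s] //=; elim: s a => [|b s IHs] a //=.
  by move=> /andP[/eqP nb /IHs ->]; rewrite andbT leqNgt nb.
have e : positions x w = iota 0 (size w).
  apply: (sorted_eq leq_trans anti_leq) => //; first exact: iota_sorted.
  have -> : iota 0 (size w) = positions w w.
    apply: (@eq_from_nth _ 0%N); rewrite ?size_iota ?size_map // => i lt_i.
    by rewrite nth_iota // (nth_map 0%N) // index_uniq.
  by apply: perm_map; rewrite perm_sym.
have <- : map (nth 0%N w) (positions x w) = x.
  rewrite -map_comp -[RHS]map_id; apply/eq_in_map => a a_in /=.
  by rewrite nth_index // (perm_mem p_w).
by rewrite e map_nth_iota0 // take_size.
Qed.

(** The descents are eliminated one by one: up to a function that ignores the
    next descent [e], the value [k e] may be replaced by [k p - k m] if [e] is [p]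
    and by zero otherwise.  In the end only the permutation without descents is
    left. *)
Lemma sum_permutations_phi (x : seq nat) (k : series) : uniq x -> x != [::] ->
  \sum_(w <- permutations x) k (descents (positions x w)) * phi_series (descents w) =
  alternating (size x).-1 k * phi_series (descents x).
Proof.
move=> u_x x_0.
have sz_d w : size (descents (positions x w)) = (size x).-1.
  by case: (x) => [|a x'] //=; rewrite size_pairmap size_map.
(* [tele] is the state after the elimination of the first [j] descents. *)
suff tele j f : (j <= (size x).-1)%N ->
    \sum_(w <- permutations x) (all (pred1 lp) (take j (descents (positions x w))))%:R *
      f (drop j (descents (positions x w))) * phi_series (descents w) =
    alternating ((size x).-1 - j) f * phi_series (descents x).
  have := tele 0%N k (leq0n _); rewrite subn0 => <-; apply: eq_bigr => w _.
  by rewrite take0 drop0 mul1r.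
move=> le_j; have [m] := ubnP ((size x).-1 - j)%N.
elim: m j f le_j => // m IHm j f; rewrite leq_eqVlt => /predU1P[-> _|lt_j le_m].
  rewrite subnn /= (bigD1_seq x) ?permutations_uniq ?mem_permutations //=.
  rewrite take_oversize ?sz_d // drop_oversize ?sz_d //.
  have -> : all (pred1 lp) (descents (positions x x)).
    have -> : positions x x = iota 0 (size x).
      apply: (@eq_from_nth _ 0%N); rewrite ?size_iota ?size_map // => i lt_i.
      by rewrite nth_iota // (nth_map 0%N) // index_uniq.
    have all_lp c n : all (pred1 lp) (gaps c (iota c.+1 n)).
      by elim: n c => //= n IHn c; rewrite ltnNge leqnSn /= IHn.
    by case: (size x) => // n; apply: all_lp.
  rewrite mul1r big1_seq ?addr0 // => w /andP[ne_w]; rewrite mem_permutations => p_w.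
  rewrite take_oversize ?sz_d //.
  case: (boolP (all _ _)) => [all_lp|_]; last by rewrite !mul0r.
  by case/eqP: ne_w; apply: positions_sorted.
rewrite -(subnSK lt_j) /=.
rewrite -(IHm j.+1) //; last by rewrite subnS; lia.
apply/eqP; rewrite -subr_eq0 -sumrB; apply/eqP.
have sz1 : size (take j.+1 x) = j.+1 by rewrite size_takel //; lia.
have sz2 : (0 < size (drop j.+1 x))%N by rewrite size_drop; lia.
have u12 : uniq (take j.+1 x ++ drop j.+1 x) by rewrite cat_take_drop.
have x1_0 : take j.+1 x != [::] by rewrite -size_eq0 sz1.
have x2_0 : drop j.+1 x != [::] by rewrite -size_eq0 -lt0n.
rewrite -[RHS](sum_ignoring_descent_eq0 (fun d => (all (pred1 lp) d)%:R) (fun d => f (lm :: d)) u12 x1_0 x2_0).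
rewrite cat_take_drop; apply: eq_bigr => w _.
set d := descents (positions x w).
have [e ed] : exists e, d = descents (positions (take j.+1 x) w) ++
    e :: descents (positions (drop j.+1 x) w).
  rewrite /d -{1}[x](cat_take_drop j.+1) /positions map_cat.
  case: (take j.+1 x) sz1 => // a s1 _; case: (drop j.+1 x) sz2 => // b s2 _.
  by eexists; rewrite [map _ (a :: s1)]/= [map _ (b :: s2)]/= descents_cat.
set d1 := descents _ in ed *; set d2 := descents _ in ed *.
have sz_d1 : size d1 = j.
  by rewrite /d1; case: (take j.+1 x) sz1 => //= a s1 [<-]; rewrite size_pairmap size_map.
rewrite ed -cat_rcons [in take j.+1 _]take_size_cat ?size_rcons ?sz_d1 //.
rewrite [in drop j.+1 _]drop_size_cat ?size_rcons ?sz_d1 //.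
rewrite cat_rcons take_size_cat // drop_size_cat // all_rcons /=.
by case: e {ed}; case: (all _ d1); rewrite /= ?mul1r ?mul0r -?mulrBl; ring.
Qed.

(** * The group ring *)

Lemma one_line_uniq n (s : 'S_n) : uniq (one_line s).
Proof. by rewrite map_inj_uniq ?enum_uniq // => i j /val_inj/perm_inj. Qed.

Lemma size_one_line n (s : 'S_n) : size (one_line s) = n.
Proof. by rewrite size_map size_enum_ord. Qed.

Lemma nth_one_line n (s : 'S_n) (i : 'I_n) : nth 0%N (one_line s) i = s i.
Proof. by rewrite (nth_map i) ?size_enum_ord // nth_ord_enum. Qed.

Lemma descent_wordE n (s : 'S_n) : descent_word s = descents (one_line s).
Proof.
apply: (@eq_from_nth _ lp).
  rewrite size_mkseq; have := size_one_line s.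
  by case: (one_line s) => [|a w] /= <- //=; rewrite size_pairmap.
rewrite size_mkseq => i lt_i; rewrite nth_mkseq //.
have := size_one_line s; case: (one_line s) => [|a w] /= sz; first by rewrite -sz in lt_i.
rewrite (nth_pairmap 0%N); last by rewrite -sz in lt_i.
by case: ltnP.
Qed.

Lemma mem_one_line n (s : 'S_n) : one_line s =i iota 0 n.
Proof.
have sub : {subset one_line s <= iota 0 n}.
  by move=> a /mapP[i _ ->]; rewrite mem_iota /= add0n.
have le_n : (size (iota 0 n) <= size (one_line s))%N by rewrite size_one_line size_iota.
by have [] := uniq_min_size (one_line_uniq s) sub le_n.
Qed.

Lemma one_line_inj n : injective (@one_line n).
Proof.
move=> s t e; apply/permP => i; apply: val_inj => /=.
by rewrite -!nth_one_line e.
Qed.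

Lemma one_line_permutations n (u : 'S_n) :
  perm_eq [seq one_line s | s <- index_enum 'S_n] (permutations (one_line u)).
Proof.
have u1 : uniq [seq one_line s | s <- index_enum 'S_n].
  by rewrite map_inj_uniq ?index_enum_uniq //; apply: one_line_inj.
apply: uniq_perm; rewrite ?permutations_uniq //.
have sub : {subset [seq one_line s | s <- index_enum 'S_n] <= permutations (one_line u)}.
  move=> w /mapP[s _ ->]; rewrite mem_permutations; apply: uniq_perm; rewrite ?one_line_uniq //.
  by move=> a; rewrite !mem_one_line.
suff le_n : (size (permutations (one_line u)) <= size [seq one_line s | s <- index_enum 'S_n])%N.
  by have [] := uniq_min_size u1 sub le_n.
rewrite size_permutations ?one_line_uniq // size_one_line size_map.
by rewrite [index_enum _]unlock -enumT -cardT -(card_Sn n) max_card.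
Qed.

Lemma positions_one_line n (u s : 'S_n) :
  positions (one_line u) (one_line (s^-1 * u)%g) = one_line s.
Proof.
apply: (@eq_from_nth _ 0%N); first by rewrite size_map !size_one_line.
rewrite size_map size_one_line => i lt_i.
rewrite (nth_map 0%N) ?size_one_line // -[i]/(val (Ordinal lt_i)) !nth_one_line.
set j := Ordinal lt_i.
have -> : u j = nth 0%N (one_line (s^-1 * u)%g) (s j) :> nat.
  by rewrite nth_one_line permM permK.
by rewrite index_uniq ?one_line_uniq // size_one_line.
Qed.

Theorem proposition6p8 (n : nat) (hn : (1 <= n)%N) :
  gr_mul (compF n) (compF n) = (n%:R * ratp (ca n)) *: compF n.
Proof.
have alt : alternating n.-1 phi_series = ca n *+ n.
  by case: (n) hn => // n' _; rewrite alternating_phi.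
pose f (s : 'S_n) := phi_series (descents (one_line s)).
have compE s : compF n s = ratp (f s) by rewrite ffunE /f -descent_wordE.
apply/ffunP => u; rewrite ffunE [RHS]ffunE compE.
have sum_s : \sum_(s : 'S_n) f s * f (s^-1 * u)%g = ca n *+ n * f u.
  transitivity (\sum_(s : 'S_n) phi_series (descents (positions (one_line u) (one_line (s^-1 * u)%g)))
      * phi_series (descents (one_line (s^-1 * u)%g))).
    by apply: eq_bigr => s _; rewrite positions_one_line.
  rewrite (reindex_inj (h := fun s => (u * s^-1)%g)) /=; last first.
    by move=> s t /mulgI/invg_inj.
  under eq_bigr do rewrite invMg invgK mulgKV.
  rewrite -(big_map (@one_line n) xpredT (fun w =>
    phi_series (descents (positions (one_line u) w)) * phi_series (descents w))).
  rewrite (perm_big _ (one_line_permutations u)) sum_permutations_phi ?one_line_uniq //.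
    by rewrite size_one_line alt.
  by rewrite -size_eq0 size_one_line -lt0n.
transitivity (ratp (\sum_(s : 'S_n) f s * f (s^-1 * u)%g)).
  rewrite (reindex_onto (fun s => (s, (s^-1 * u)%g)) fst) /=; last first.
    by move=> [s t] /= /eqP <-; rewrite mulKg.
  rewrite /ratp rmorph_sum; apply: eq_big => s; first by rewrite mulKVg !eqxx.
  by move=> _; rewrite !compE /ratp rmorphM.
rewrite sum_s /ratp rmorphM rmorphMn /=.
by rewrite -mulr_natl.
Qed.
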